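(* Let $\overline{d}$ denote the average degree of the input graph. There exists an $\alpha$-erasure-resilient $\varepsilon$-tester for connectedness of graphs with average degree $\overline{d}$ (where $\overline{d}$ is given to the tester) that has 1-sided error, has query and time complexity $$O\Big(\min\Big\{\frac{1}{((\varepsilon - 2\alpha)\overline{d})^2},\ \frac{1}{\varepsilon-2\alpha} \log \frac{1}{(\varepsilon-2\alpha)\overline{d}}\Big\}\Big),$$ and works for every $\varepsilon \in (0,2/\overline{d})$ and every $\alpha \in [0,\varepsilon/2)$. Moreover, when the average degree $\overline{d}$ of the input graph is unknown to the tester, $\alpha$-erasure-resilient $\varepsilon$-testing of connectedness (with 1-sided error) can be done with query and time complexity $O\big(\frac{1}{\varepsilon-2\alpha}\log\frac{1}{\varepsilon-2\alpha}\big)$.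
   Context: Graphs are simple and undirected, on a vertex set $V$ with $n=|V|$, represented by adjacency lists. For $\alpha\in[0,1]$, an $\alpha$-erased graph is the concatenation of the adjacency lists of a simple undirected graph $(V,E)$ in which at most $2\alpha|E|$ entries (an $\alpha$ fraction of all entries) have been replaced by a special symbol $\bot$ (erased). A completion of an $\alpha$-erased graph $G$ is the adjacency-list representation of a simple undirected graph on $V$ that coincides with $G$ on all nonerased entries (so list lengths are unchanged). $m$ denotes half the total length of all adjacency lists (the number of edges of any completion), $\mathrm{adj}(u)$ the adjacency list of $u$, $\deg(u)$ its length, and $\overline{d}=2m/n$ the average degree. An algorithm accesses $G$ via degree queries (given $v$, return $\deg(v)$) and neighbor queries (given $(v,i)$, return the $i$-th entry of $\mathrm{adj}(v)$, which may be $\bot$). A partially erased graph $G$ has a property $\mathcal{P}$ (here: connectedness) if some completion of $G$ has $\mathcal{P}$; $G$ is $\varepsilon$-far from $\mathcal{P}$ if every completion of $G$ differs in at least $\varepsilon m$ edges from every graph having $\mathcal{P}$. An $\alpha$-erasure-resilient $\varepsilon$-tester for $\mathcal{P}$ gets $\alpha,\varepsilon$ and query access to an $\alpha$-erased graph $G$, accepts with probability at least $2/3$ if $G$ has $\mathcal{P}$, and rejects with probability at least $2/3$ if $G$ is $\varepsilon$-far from $\mathcal{P}$; 1-sided error means graphs having $\mathcal{P}$ are accepted with probability 1.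
   Formalization: O(f) is read as at most C·max(1,f), since f is negative or below 1 for some parameters (e.g. (ε−2α)d̄ in (1,2)); graphs with d̄ = 0 are excluded when d̄ is given, and the one-vertex graph (both connected and ε-far) when d̄ is unknown. *)

(* Defs.v *)
From HB Require Import structures.
From mathcomp Require Import all_boot all_order all_algebra.
From mathcomp Require Import reals exp.
Set Implicit Arguments.
Unset Strict Implicit.
Unset Printing Implicit Defensive.
Import Order.TTheory GRing.Theory Num.Theory.
Local Open Scope ring_scope.

(** * Graphs and partially erased graphs *)

Definition simple_graph (V : finType) (E : {set {set V}}) : Prop :=
  forall e, e \in E -> #|e| = 2%N.

(* Irreflexive when [E] is a simple graph, since [[set u; u]] has one element. *)
Definition adjacent (V : finType) (E : {set {set V}}) : rel V :=
  fun u v => [set u; v] \in E.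

Definition connected_graph (V : finType) (E : {set {set V}}) : Prop :=
  forall u v : V, connect (adjacent E) u v.

(* The order inside each list is arbitrary. *)
Definition adjacency_lists (V : finType) (E : {set {set V}})
    (L : V -> seq V) : Prop :=
  forall u, uniq (L u) /\ L u =i adjacent E u.

(* Adjacency lists on the vertex set 'I_n; [None] is the erased symbol. *)
Definition erased_lists (n : nat) := 'I_n -> seq (option 'I_n).

(* [all2] also forces the two lists to have the same length. *)
Definition coincides (n : nat) (G : erased_lists n) (L : 'I_n -> seq 'I_n) :
    Prop :=
  forall u, all2 (fun o v => (o == None) || (o == Some v)) (G u) (L u).

(* [E] is the graph represented by some completion of [G]. *)
Definition completion (n : nat) (G : erased_lists n) (E : {set {set 'I_n}}) :
    Prop :=
  simple_graph E /\
  exists L : 'I_n -> seq 'I_n, adjacency_lists E L /\ coincides G L.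

Definition num_erased (n : nat) (G : erased_lists n) : nat :=
  \sum_(u < n) count_mem None (G u).

(* Replacing entries of the lists of [E] by the erased symbol yields [G]
   exactly when [E] is represented by a completion of [G]. *)
Definition alpha_erased (R : realType) (alpha : R) (n : nat)
    (G : erased_lists n) : Prop :=
  0 <= alpha <= 1 /\
  exists E : {set {set 'I_n}},
    completion G E /\ (num_erased G)%:R <= 2 * alpha * #|E|%:R.

Definition num_edges (R : realType) (n : nat) (G : erased_lists n) : R :=
  (\sum_(u < n) size (G u))%:R / 2.

Definition avg_deg (R : realType) (n : nat) (G : erased_lists n) : R :=
  2 * num_edges R G / n%:R.

Definition has_connectedness (n : nat) (G : erased_lists n) : Prop :=
  exists E, completion G E /\ connected_graph E.

Definition edge_distance (V : finType) (E1 E2 : {set {set V}}) : nat :=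
  #|(E1 :\: E2) :|: (E2 :\: E1)|.

Definition far_from_connectedness (R : realType) (eps : R) (n : nat)
    (G : erased_lists n) : Prop :=
  forall E E', completion G E -> simple_graph E' -> connected_graph E' ->
    eps * num_edges R G <= (edge_distance E E')%:R.

(** * Query access *)

(* Vertices are presented to algorithms as the numbers 0, ..., n - 1, and list
   positions start at 0.  Arguments that are not vertices have an empty list. *)
Definition list_of (n : nat) (G : erased_lists n) (v : nat) :
    seq (option 'I_n) :=
  if insub v is Some u then G u else [::].

Definition degree_query (n : nat) (G : erased_lists n) (v : nat) : nat :=
  size (list_of G v).

(* The answer is 0 for an erased (or nonexistent) entry, u + 1 for vertex u. *)
Definition neighbor_query (n : nat) (G : erased_lists n) (v i : nat) : nat :=
  if nth None (list_of G v) i is Some u then (val u).+1 else 0%N.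

(** * Randomized random-access machine

    Integer memory is an array of naturals with indirect addressing.  Integer
    arithmetic is limited to addition and truncated subtraction, so that unit
    cost is not abusive.  Real registers hold the (real) parameters; they
    support field operations and comparisons, but no rounding to integers and
    no real constants other than integers.  A program is a finite piece of
    syntax, independent of the input, so evaluating one of its expressions is
    a constant number of machine operations. *)

Inductive iexp :=
| ICst of nat
| ILoad of iexp
| IAdd of iexp & iexp
| ISub of iexp & iexp.

Inductive rexp :=
| RReg of nat
| ROfInt of iexp
| RAdd of rexp & rexp
| RSub of rexp & rexp
| RMul of rexp & rexp
| RDiv of rexp & rexp.

Inductive bexp :=
| BIle of iexp & iexp
| BRle of rexp & rexp
| BNot of bexp
| BAnd of bexp & bexp.

(* The first expression of [IStore], [Random], [QueryDeg] and [QueryNbr] is the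
   address of the memory cell that receives the result. *)
Inductive prog :=
| Skip
| Seq of prog & prog
| If of bexp & prog & prog
| While of bexp & prog
| IStore of iexp & iexp
| RStore of nat & rexp
| Random of iexp & iexp
| QueryDeg of iexp & iexp
| QueryNbr of iexp & iexp & iexp.

(* [todo] is the stack of program fragments that remain to be executed;
   [queries] counts the queries made so far and is invisible to programs. *)
Record config (R : realType) := Config {
  todo : seq prog;
  imem : nat -> nat;
  rmem : nat -> R;
  queries : nat }.

Fixpoint ieval (M : nat -> nat) (e : iexp) : nat :=
  match e with
  | ICst k => k
  | ILoad a => M (ieval M a)
  | IAdd a b => (ieval M a + ieval M b)%N
  | ISub a b => (ieval M a - ieval M b)%N
  end.

Fixpoint reval (R : realType) (M : nat -> nat) (N : nat -> R) (e : rexp) : R :=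
  match e with
  | RReg k => N k
  | ROfInt a => (ieval M a)%:R
  | RAdd a b => reval M N a + reval M N b
  | RSub a b => reval M N a - reval M N b
  | RMul a b => reval M N a * reval M N b
  | RDiv a b => reval M N a / reval M N b
  end.

Fixpoint beval (R : realType) (M : nat -> nat) (N : nat -> R) (e : bexp) :
    bool :=
  match e with
  | BIle a b => (ieval M a <= ieval M b)%N
  | BRle a b => reval M N a <= reval M N b
  | BNot a => ~~ beval M N a
  | BAnd a b => beval M N a && beval M N b
  end.

Definition update (T : Type) (f : nat -> T) (a : nat) (x : T) : nat -> T :=
  fun b => if b == a then x else f b.

(* The equally likely successors of a configuration: there is one of them,
   except for [Random a e], which stores at [a] a uniform number among
   0, ..., k - 1, where k is the maximum of 1 and the value of [e]. *)
Definition step (R : realType) (n : nat) (G : erased_lists n) (c : config R) :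
    seq (config R) :=
  let: Config s M N q := c in
  if s is p :: s' then
    match p with
    | Skip => [:: Config s' M N q]
    | Seq p1 p2 => [:: Config (p1 :: p2 :: s') M N q]
    | If b p1 p2 =>
        [:: Config ((if beval M N b then p1 else p2) :: s') M N q]
    | While b p1 =>
        [:: Config (if beval M N b then p1 :: p :: s' else s') M N q]
    | IStore a e =>
        [:: Config s' (update M (ieval M a) (ieval M e)) N q]
    | RStore k e => [:: Config s' M (update N k (reval M N e)) q]
    | Random a e =>
        [seq Config s' (update M (ieval M a) x) N q
           | x <- iota 0 (maxn 1 (ieval M e))]
    | QueryDeg a v =>
        [:: Config s' (update M (ieval M a) (degree_query G (ieval M v)))
              N q.+1]
    | QueryNbr a v i =>
        [:: Config s'
              (update M (ieval M a)
                 (neighbor_query G (ieval M v) (ieval M i)))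
              N q.+1]
    end
  else [::].

Definition halted (R : realType) (c : config R) : bool := nilp (todo c).

Definition accepting (R : realType) (c : config R) : bool := imem c 0 != 0%N.

(* Whatever the random choices, a run from [c] stops within [t] steps, with a
   query counter that is at most [q] at the end. *)
Fixpoint stops_within (R : realType) (n : nat) (G : erased_lists n)
    (t q : nat) (c : config R) : bool :=
  if halted c then (queries c <= q)%N
  else if t is t'.+1 then all (stops_within G t' q) (step G c) else false.

(* Probability that a run from [c] stops within [t] steps with output [b]. *)
Fixpoint prob_output (R : realType) (n : nat) (G : erased_lists n)
    (b : bool) (t : nat) (c : config R) : R :=
  if halted c then (accepting c == b)%:R
  else if t is t'.+1 then
    (\sum_(c' <- step G c) prob_output G b t' c') / (size (step G c))%:R
  else 0.

(* The number of vertices is in memory cell 0 and the real parameters are in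
   the first real registers; everything else is 0. *)
Definition initial (R : realType) (P : prog) (n : nat) (params : seq R) :
    config R :=
  Config [:: P] (update (fun _ => 0%N) 0 n) (nth 0 params) 0.

(** * Testers *)

(* On the input [G], the program behaves as a 1-sided error [eps]-tester, and
   its (worst-case) running time and number of queries are at most [B]. *)
Definition tests_connectedness (R : realType) (P : prog) (params : seq R)
    (n : nat) (G : erased_lists n) (eps B : R) : Prop :=
  exists t q : nat,
    [/\ t%:R <= B /\ q%:R <= B,
        stops_within G t q (initial P n params),
        has_connectedness G ->
          prob_output G true t (initial P n params) = 1
      & far_from_connectedness eps G ->
          2 / 3 <= prob_output G false t (initial P n params)].

(* O(f) for a resource of which every algorithm uses at least a constant
   amount: [f] may be smaller than 1, or even negative because of a logarithm
   of a number below 1, and is then replaced by 1. *)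
Definition big_O_bound (R : realType) (C f : R) : R := C * Num.max 1 f.

(* Main.v *)
Require Import Defs.
From mathcomp Require Import all_boot all_order all_algebra.
From mathcomp Require Import reals exp.
From mathcomp Require Import ring lra zify.
Import Order.TTheory GRing.Theory Num.Theory.
Set Implicit Arguments.
Unset Strict Implicit.
Unset Printing Implicit Defensive.
Local Open Scope ring_scope.

(* Searches from random vertices look for a set of vertices other than the whole
   vertex set, without erased entries, that no edge leaves: such a set refutes
   connectedness of every completion.  If the graph is far from connected, a
   completion has more than [eps * m] components, and at most [2 * alpha * m] of
   them contain an erased entry; each of the others can be found.

   To balance cost against success probability, the budget of a search from [u]
   is random: with [y] uniform in {1, ..., K} it is [(deg u + 1) K / y], so that
   a component [C] is explored with probability about (deg u + 1) / vol C when
   the search starts at [u], where vol C is the sum of [deg v + 1] over C.  These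
   ratios add up to 1 over C, so every component without erased entries
   contributes about 1 / n to the success probability, while a search costs
   O(d log K) on average.  The budget [(K / y)^2] replaces the ratio by 1 / |C|
   and the cost by O(K).  Searches are repeated until the total work reaches a
   constant multiple of the ratio of average cost to success probability, which
   does not involve the average degree d for the first kind of budget.  If d < 1,
   there is an isolated vertex, and the input can be rejected at once when d is
   known. *)

(** * Running programs *)

Section Execution.
Variables (R : realType) (n : nat) (G : erased_lists n).

(* [avg] combines the values of the equally likely outcomes, so that the same
   transformer serves both expectations and worst-case analysis. *)
Fixpoint wp (T : Type) (avg : seq T -> T) (p : prog)
    (f : (nat -> nat) -> (nat -> R) -> nat -> T)
    (M : nat -> nat) (N : nat -> R) (q : nat) : T :=
  match p with
  | Skip => f M N q
  | Seq p1 p2 => wp avg p1 (wp avg p2 f) M N q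
  | If b p1 p2 => if beval M N b then wp avg p1 f M N q else wp avg p2 f M N q
  | While _ _ => f M N q
  | IStore a e => f (update M (ieval M a) (ieval M e)) N q
  | RStore k e => f M (update N k (reval M N e)) q
  | Random a e =>
      avg [seq f (update M (ieval M a) x) N q | x <- iota 0 (maxn 1 (ieval M e))]
  | QueryDeg a v =>
      f (update M (ieval M a) (degree_query G (ieval M v))) N q.+1
  | QueryNbr a v i =>
      f (update M (ieval M a) (neighbor_query G (ieval M v) (ieval M i))) N q.+1
  end.

Fixpoint loop_free (p : prog) : bool :=
  match p with
  | Seq p1 p2 | If _ p1 p2 => loop_free p1 && loop_free p2
  | While _ _ => false
  | _ => true
  end.

Fixpoint cost (p : prog) : nat :=
  match p with
  | Seq p1 p2 => (cost p1 + cost p2).+1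
  | If _ p1 p2 => (maxn (cost p1) (cost p2)).+1
  | _ => 1
  end.

Section Run.
Variables (T : Type) (le : T -> T -> Prop) (avg : seq T -> T).
Variables (hval : config R -> T) (bot : T).

(** With [mean] this is an output probability, with [all id] a guarantee for all random choices;
    [bot] is the value of a run that exhausts its fuel [t]. *)
Fixpoint run (t : nat) (c : config R) : T :=
  if halted c then hval c
  else if t is t'.+1 then avg [seq run t' c' | c' <- step G c] else bot.

(** [outcome_bot] speaks of runs only, since 0 is below probabilities but not below all reals. *)
Record outcome_order : Prop := OutcomeOrder {
  outcome_refl : forall x, le x x;
  outcome_trans : forall x y z, le x y -> le y z -> le x z;
  outcome_bot : forall t c, le bot (run t c);
  outcome_single : forall x, avg [:: x] = x;
  outcome_mono : forall (A : Type) (s : seq A) (f g : A -> T),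
    (forall x, le (f x) (g x)) -> le (avg (map f s)) (avg (map g s)) }.

Hypothesis ord : outcome_order.

Lemma run_monoS t c : le (run t c) (run t.+1 c).
Proof.
elim: t c => [|t IH] c.
  have := outcome_bot ord 1 c; rewrite [run 0 c]/= [run 1 c]/=; case: ifP => _ // _.
  exact: (outcome_refl ord).
rewrite [run t.+1 c]/= [run t.+2 c]/=; case: ifP => _; first exact: (outcome_refl ord).
exact: (outcome_mono ord).
Qed.

Lemma run_mono t t' c : (t <= t')%N -> le (run t c) (run t' c).
Proof.
move=> /subnK <-; elim: (t' - t)%N => [|k IH]; first exact: (outcome_refl ord).
by rewrite addSn; apply: (outcome_trans ord) IH (run_monoS _ _).
Qed.

Lemma wp_mono p f g : (forall M N q, le (f M N q) (g M N q)) ->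
  forall M N q, le (wp avg p f M N q) (wp avg p g M N q).
Proof.
elim: p f g => [|p1 IH1 p2 IH2|b p1 IH1 p2 IH2|b p IH|a e|k e|a e|a v|a v i]
  f g fg M N q //=.
- by apply: IH1; apply: IH2.
- by case: ifP => _; [apply: IH1 | apply: IH2].
- exact: (outcome_mono ord).
Qed.

Lemma run_Seq t p1 p2 s M N q :
  run t.+1 (Config (Seq p1 p2 :: s) M N q) =
  run t (Config [:: p1, p2 & s] M N q).
Proof. by rewrite /= (outcome_single ord). Qed.

Lemma run_If t b p1 p2 s M N q :
  run t.+1 (Config (If b p1 p2 :: s) M N q) =
  run t (Config ((if beval M N b then p1 else p2) :: s) M N q).
Proof. by rewrite /= (outcome_single ord). Qed.

Lemma run_While t b p s M N q :
  run t.+1 (Config (While b p :: s) M N q) =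
  run t (Config (if beval M N b then [:: p, While b p & s] else s) M N q).
Proof. by rewrite /= (outcome_single ord). Qed.

(** Only an inequality: [cost] charges the longer branch of each [If], and spare fuel can only raise
    the value. Loops are excluded because [wp] skips them. *)
Lemma run_wp t p s M N q : loop_free p ->
  le (wp avg p (fun M N q => run t (Config s M N q)) M N q)
     (run (cost p + t) (Config (p :: s) M N q)).
Proof.
elim: p t s M N q => [|p1 IH1 p2 IH2|b p1 IH1 p2 IH2|b p IH|a e|k e|a e|a v|a v i]
  t s M N q //=; rewrite ?(outcome_single ord); try by move=> _; exact: (outcome_refl ord).
- move=> /andP[l1 l2]; rewrite -addnA.
  by apply: (outcome_trans ord) (IH1 _ _ _ _ _ l1); apply: wp_mono => *; apply: IH2.
- move=> /andP[l1 l2]; case: ifP => _.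
    by apply: (outcome_trans ord) (IH1 _ _ _ _ _ l1) _; apply: run_mono; lia.
  by apply: (outcome_trans ord) (IH2 _ _ _ _ _ l2) _; apply: run_mono; lia.
- by move=> _; rewrite -map_comp; exact: (outcome_refl ord).
Qed.

End Run.
End Execution.

Arguments wp {R n} G {T}.

(** * Output probabilities and worst-case guarantees as runs *)

Definition mean (R : realType) (s : seq R) : R := (\sum_(x <- s) x) / (size s)%:R.

Lemma mean1 (R : realType) (x : R) : mean [:: x] = x.
Proof. by rewrite /mean big_seq1 divr1. Qed.

Lemma mean_mono (R : realType) (A : Type) (s : seq A) (f g : A -> R) :
  (forall x, f x <= g x) -> mean (map f s) <= mean (map g s).
Proof.
move=> fg; rewrite /mean !big_map !size_map ler_wpM2r ?invr_ge0 ?ler0n //.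
exact: ler_sum.
Qed.

Lemma prob_output_run (R : realType) n (G : erased_lists n) b t c :
  prob_output G b t c =
  run G (@mean R) (fun c => (accepting c == b)%:R) 0 t c.
Proof.
elim: t c => [|t IH] c //=; case: ifP => // _.
by rewrite /mean big_map size_map; congr (_ / _); apply: eq_bigr.
Qed.

Definition safe_end (R : realType) (b : bool) (Q : nat) (c : config R) : bool :=
  (queries c <= Q)%N && (b ==> accepting c).

Lemma safe_stops (R : realType) n (G : erased_lists n) b Q t c :
  run G (all id) (@safe_end R b Q) false t c -> stops_within G t Q c.
Proof.
elim: t c => [|t IH] c /=; case: ifP => // _; first by case/andP.
  by case/andP.
by rewrite all_map; apply: sub_all => c' /= /IH.
Qed.

Lemma safe_accepts (R : realType) n (G : erased_lists n) Q t c :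
  run G (all id) (@safe_end R true Q) false t c -> prob_output G true t c = 1.
Proof.
elim: t c => [|t IH] c /=; case: ifP => // hc; rewrite /safe_end /=.
- by case/andP=> _ ->.
- by case/andP=> _ ->.
rewrite all_map => H.
(* An average of ones is 1 only if there is a successor; [Random] has one because of its
   [maxn 1]. *)
have nz : size (step G c) != 0%N.
  case: c hc {H} => -[|p s] M N q //= _.
  by case: p => //= a e; rewrite size_map size_iota; lia.
move: (step G c) H nz => s H nz.
have -> : \sum_(c' <- s) prob_output G true t c' = \sum_(c' <- s) 1.
  elim: s H {nz} => [|c' s IHs] H; first by rewrite !big_nil.
  by move: H => /= /andP[/IH E /IHs Es]; rewrite !big_cons E Es.
by rewrite big_const_seq count_predT iter_addr_0 divff // pnatr_eq0.
Qed.

Lemma safe_order (R : realType) n (G : erased_lists n) b Q :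
  outcome_order G (fun x y : bool => x -> y) (all id) (@safe_end R b Q) false.
Proof.
split=> //; first by move=> x y z xy yz /xy.
  by move=> x /=; rewrite andbT.
by move=> A s f g fg; elim: s => //= x s IHs /andP[/fg -> /IHs].
Qed.

Lemma mean_order (R : realType) n (G : erased_lists n) (hval : config R -> R) :
  (forall c, 0 <= hval c) ->
  outcome_order G (fun x y : R => x <= y) (@mean R) hval 0.
Proof.
move=> h0; split=> //.
- by move=> x y z; apply: le_trans.
- elim=> [|t IH] c /=; case: ifP => // _.
  by rewrite mulr_ge0 ?invr_ge0 ?ler0n // big_map sumr_ge0.
- exact: mean1.
- exact: mean_mono.
Qed.

(** * The tester and one unit of its work *)

Definition cell (a : nat) : iexp := ILoad (ICst a).
Definition mark_of (v : iexp) : iexp := IAdd (ICst 20) (IAdd v v).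
Definition queue_at (j : iexp) : iexp := IAdd (ICst 21) (IAdd j j).
Definition blk : seq prog -> prog := foldr Seq Skip.

(* Cells: 0 number of vertices (set to 0 to reject), 1 largest value K of [y],
   2 the binary logarithm of K,
   3 total work, 4 work of the current search, 5 [y], 7 current vertex,
   8 its degree, 9 position in its list, 10 number of processed vertices,
   11 number of discovered vertices, 12 mark of the current search,
   13 whether a search is in progress, 14 query answer.  Vertex [x] is discovered
   when cell [20 + 2 x] contains the mark; the discovered vertices are listed
   in cells 21, 23, ...  Registers: 5 bound on the total work, 6 budget of the
   current search, 7 [eps - 2 * alpha], or 1 if the degree is unknown and this is
   larger, 8 lower bound on K, 9 an alternative to register 5. *)
Definition start_search (be : rexp) : prog := blk
  [:: IStore (ICst 12) (IAdd (cell 12) (ICst 1));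
      Random (ICst 7) (cell 0);
      Random (ICst 5) (cell 1);
      IStore (ICst 5) (IAdd (cell 5) (ICst 1));
      QueryDeg (ICst 8) (cell 7);
      RStore 6 be;
      IStore (ICst 4) (ICst 0);
      IStore (ICst 9) (ICst 0);
      IStore (ICst 10) (ICst 0);
      IStore (ICst 11) (ICst 1);
      IStore (mark_of (cell 7)) (cell 12);
      IStore (ICst 21) (cell 7);
      IStore (ICst 13) (ICst 1)].

Definition stop_search : prog := IStore (ICst 13) (ICst 0).

(** Answer 0 is an erased entry and ends the search; otherwise the vertex is the answer minus 1. The
    two inequalities together test whether its mark is the current one. *)
Definition explore_entry : prog := blk
  [:: QueryNbr (ICst 14) (cell 7) (cell 9);
      IStore (ICst 9) (IAdd (cell 9) (ICst 1));
      If (BIle (cell 14) (ICst 0)) stop_search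
        (If (BAnd (BIle (ILoad (mark_of (ISub (cell 14) (ICst 1)))) (cell 12))
                  (BIle (cell 12) (ILoad (mark_of (ISub (cell 14) (ICst 1))))))
            Skip
            (blk [:: IStore (mark_of (ISub (cell 14) (ICst 1))) (cell 12);
                     IStore (queue_at (cell 11)) (ISub (cell 14) (ICst 1));
                     IStore (ICst 11) (IAdd (cell 11) (ICst 1))]))].

(** An exhausted queue means that a closed set has been found, which refutes connectedness unless it
    is everything. Zeroing cell 0 both records rejection and ends the loop. *)
Definition next_vertex : prog := blk
  [:: IStore (ICst 10) (IAdd (cell 10) (ICst 1));
      If (BIle (cell 11) (cell 10))
        (If (BIle (cell 0) (cell 11)) stop_search (IStore (ICst 0) (ICst 0)))
        (blk [:: IStore (ICst 7) (ILoad (queue_at (cell 10)));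
                 QueryDeg (ICst 8) (cell 7);
                 IStore (ICst 9) (ICst 0)])].

Definition search_step : prog := blk
  [:: IStore (ICst 4) (IAdd (cell 4) (ICst 1));
      If (BRle (ROfInt (cell 4)) (RReg 6))
        (If (BIle (cell 8) (cell 9)) next_vertex explore_entry)
        stop_search].

(** A unit makes at most one query and takes boundedly many steps, so counting units bounds queries
    and time at once. *)
Definition work_unit (be : rexp) : prog := blk
  [:: IStore (ICst 3) (IAdd (cell 3) (ICst 1));
      If (BIle (cell 13) (ICst 0)) (start_search be) search_step].

Definition work_left : bexp :=
  BAnd (BIle (ICst 1) (cell 0)) (BNot (BRle (RReg 5) (ROfInt (cell 3)))).

Definition search_loop (be : rexp) : prog := While work_left (work_unit be).

Ltac skip_updates :=
  repeat match goal with |- context [if ?a == ?b then _ else _] =>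
    rewrite (_ : (a == b) = false); last by lia end.

(** * Invariant of a search *)

Section Search.
Variables (R : realType) (n : nat) (G : erased_lists n).

Notation deg := (degree_query G).

Definition entry_in (Q : seq nat) (v i : nat) : bool :=
  (0 < neighbor_query G v i)%N && ((neighbor_query G v i).-1 \in Q).

Definition closed_list (Q : seq nat) : Prop :=
  forall v i, v \in Q -> (i < deg v)%N -> entry_in Q v i.

(** The work of exploring [Q]: one unit per list entry and one more to leave each vertex. *)
Definition volume (Q : seq nat) : nat := \sum_(v <- Q) (deg v).+1.

(** Breadth-first search with queue [Q]: its first [M 10] vertices are fully read, and so are the
    first [M 9] entries of the current vertex [M 7]. *)
Record searching (M : nat -> nat) (Q : seq nat) : Prop := Searching {
  s_on : M 13 = 1%N;
  s_count : M 11 = size Q;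
  s_queue : forall j, (j < size Q)%N -> M (21 + (j + j))%N = nth 0%N Q j;
  s_uniq : uniq Q;
  s_vertices : all (fun x => (x < n)%N) Q;
  s_mark : forall x, (x < n)%N -> (M (20 + (x + x))%N == M 12) = (x \in Q);
  s_done : (M 10 < size Q)%N;
  s_current : M 7 = nth 0%N Q (M 10);
  s_degree : M 8 = deg (M 7);
  s_position : (M 9 <= M 8)%N;
  s_closed : forall j i, (j < M 10)%N -> (i < deg (nth 0%N Q j))%N ->
    entry_in Q (nth 0%N Q j) i;
  s_entries : forall i, (i < M 9)%N -> entry_in Q (M 7) i;
  s_work : M 4 = (volume (take (M 10) Q) + M 9)%N }.

(** Since no mark exceeds cell 12, incrementing that cell invalidates all marks at once. *)
Record between (K : nat) (M : nat -> nat) : Prop := Between {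
  b_n : M 0 = n;
  b_K : M 1 = K;
  b_mark : forall x, (x < n)%N -> (M (20 + (x + x)) <= M 12)%N }.

Lemma neighbor_query_le v i : (neighbor_query G v i <= n)%N.
Proof. by rewrite /neighbor_query; case: (nth _ _ _) => [u|//]; apply: ltn_ord. Qed.

Lemma entry_in_sub Q Q' v i :
  {subset Q <= Q'} -> entry_in Q v i -> entry_in Q' v i.
Proof. by rewrite /entry_in => sub /andP[-> /sub ->]. Qed.

(** The reasons for giving up are recorded because none can arise inside a closed proper set whose
    volume is within the budget; the origin of a new vertex is recorded to keep [Q] inside such a
    set. *)
Inductive step_outcome K (M M' : nat -> nat) (budget : R) (Q : seq nat) : Prop :=
| Abandoned of between K M' & M' 13 = 0%N &
   [\/ budget < (M 4).+1%:R,
       exists v i, [/\ v \in Q, (i < deg v)%N & neighbor_query G v i = 0%N]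
     | closed_list Q /\ (n <= size Q)%N]
| Rejected of M' 0 = 0%N & closed_list Q & (size Q < n)%N
| Continued Q' of between K M' & searching M' Q' & M' 4 = (M 4).+1 &
   (M 4).+1%:R <= budget &
   Q' = Q \/ exists v i, [/\ v \in Q, (i < deg v)%N,
                           (0 < neighbor_query G v i)%N
                         & Q' = rcons Q (neighbor_query G v i).-1].

(** During a search nothing is random, so the transformer reduces to a single successor whatever
    [avg] is. *)
Lemma search_step_outcome K be M (N : nat -> R) q Q :
  between K M -> searching M Q ->
  exists M' q', [/\ forall (T : Type) (avg : seq T -> T) f,
      wp G avg (work_unit be) f M N q = f M' N q',
    (q' <= q.+1)%N, M' 3 = (M 3).+1 & step_outcome K M M' (N 6) Q].
Proof.
move=> [bn bK bm] [s13 s11 sq su sv sm s10 s7 s8 s9 sc se s4].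
have cur_in : M 7 \in Q by rewrite s7 mem_nth.
case: (boolP ((M 4).+1%:R <= N 6)) => bud; last first.
  (* The new memory is left open and read off from the symbolic execution by [reflexivity], here and
     in the later cases. *)
  eexists; exists q; split=> //.
  - move=> T avg f; rewrite /= /update /= s13 /= !addn1 (negbTE bud); reflexivity.
  - by [].
  constructor 1 => //; last by constructor 1; rewrite real_ltNge ?num_real.
case: (leqP (M 8) (M 9)) => pos.
  have e98 : M 9 = M 8 by apply/eqP; rewrite eqn_leq s9 pos.
  (* The unit that leaves the vertex accounts for the successor in [volume]. *)
  have vol' : (volume (take (M 10) Q) + M 9).+1 = volume (take (M 10).+1 Q).
    by rewrite (take_nth 0%N) // /volume big_rcons /= -s7 e98 s8; lia.
  have closed' j i : (j < (M 10).+1)%N -> (i < deg (nth 0%N Q j))%N ->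
      entry_in Q (nth 0%N Q j) i.
    rewrite ltnS leq_eqVlt => /orP[/eqP-> | /sc H]; last exact: H.
    by rewrite -s7 -s8 -e98; apply: se.
  case: (leqP (M 11) (M 10).+1) => lst.
    have closedQ : closed_list Q.
      move=> v i /(nthP 0%N)[j jQ <-]; apply: closed'.
      by apply: leq_trans lst; rewrite s11.
    case: (leqP (M 0) (M 11)) => big.
      eexists; exists q; split=> //.
      - move=> T avg f; rewrite /= /update /= s13 /= !addn1 bud pos lst big; reflexivity.
      - by [].
      constructor 1 => //; last by constructor 3; rewrite -bn -s11.
    eexists; exists q; split=> //.
    - move=> T avg f; rewrite /= /update /= s13 /= !addn1 bud pos lst leqNgt big; reflexivity.
    - by [].
    by constructor 2 => //; rewrite -bn -s11.
  eexists; exists q.+1; split=> //.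
  - move=> T avg f; rewrite /= /update /= s13 /= !addn1 bud pos leqNgt lst; reflexivity.
  - by [].
  have next : ((M 10).+1 < size Q)%N by rewrite -s11.
  apply: (Continued (Q' := Q)) => //; last by left.
  split=> //=; skip_updates; try by [].
  - by rewrite sq.
  - by rewrite s4 -vol' addn0.
case: (posnP (neighbor_query G (M 7) (M 9))) => [nb0|nb].
  eexists; exists q.+1; split=> //.
  - move=> T avg f; rewrite /= /update /= s13 /= !addn1 bud leqNgt pos nb0; reflexivity.
  - by [].
  constructor 1 => //.
  by constructor 2; exists (M 7), (M 9); rewrite -s8.
have := neighbor_query_le (M 7) (M 9).
case nbE: (neighbor_query G (M 7) (M 9)) nb => [//|r] _ rn.
have entE : entry_in Q (M 7) (M 9) = (r \in Q) by rewrite /entry_in nbE.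
case: (boolP (r \in Q)) => rQ.
  eexists; exists q.+1; split=> //.
  - move=> T avg f; rewrite /= /update /= s13 /= !addn1 bud leqNgt pos nbE /= subn1 /=.
    move: rQ; rewrite -sm // => /eqP ->; rewrite leqnn /=; reflexivity.
  - by [].
  apply: (Continued (Q' := Q)) => //; last by left.
  split=> //=; skip_updates; try by [].
  - move=> i; rewrite ltnS leq_eqVlt => /orP[/eqP->|]; last exact: se.
    by rewrite entE rQ.
  - by rewrite s4 addnS.
eexists; exists q.+1; split=> //.
- move=> T avg f; rewrite /= /update /= s13 /= !addn1 bud leqNgt pos nbE /= subn1 /=.
  move: (rQ); rewrite -sm // -eqn_leq => /negbTE ->; reflexivity.
- by [].
have rQ' : r \in rcons Q r by rewrite mem_rcons mem_head.
have subQ : {subset Q <= rcons Q r} by move=> x; rewrite mem_rcons inE orbC => ->.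
apply: (Continued (Q' := rcons Q r)) => //;
  last by right; exists (M 7), (M 9); rewrite nbE -s8.
  split=> //= x xn; skip_updates.
  by case: eqP => _ //; apply: bm.
split=> //=; skip_updates; try by [].
- by rewrite size_rcons s11.
- move=> j; rewrite size_rcons ltnS leq_eqVlt nth_rcons s11 => /orP[/eqP->|jQ].
    by rewrite ltnn !eqxx.
  by skip_updates; rewrite jQ sq.
- by rewrite rcons_uniq rQ.
- by rewrite all_rcons sv rn.
- move=> x xn; skip_updates; rewrite mem_rcons inE -sm //.
  case: (eqVneq x r) => [->|xr]; first by rewrite eqxx eqxx.
  by skip_updates.
- by rewrite size_rcons ltnS ltnW.
- by rewrite nth_rcons s10.
- move=> j i jM; have jQ := ltn_trans jM s10.
  by rewrite nth_rcons jQ => iG; apply: entry_in_sub (sc _ _ jM iG).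
- move=> i; rewrite ltnS leq_eqVlt => /orP[/eqP->|]; last first.
    by move/se; apply: entry_in_sub.
  by rewrite /entry_in nbE.
- by rewrite s4 addnS -cats1 takel_cat // ltnW.
Qed.
End Search.

(** [beta] abstracts the budget expression as a function of the degree plus one and the draw, so
    that both kinds of budget share one analysis. *)
Lemma start_search_outcome (R : realType) n (G : erased_lists n) K be
    (beta : nat -> nat -> R) M (N : nat -> R) q :
  (forall (M : nat -> nat) N, M 1 = K -> reval M N be = beta (M 8).+1 (M 5)) ->
  between n K M -> M 13 = 0%N ->
  exists Mf Nf, [/\ forall (T : Type) (avg : seq T -> T) f,
      wp G avg (work_unit be) f M N q =
      avg [seq avg [seq f (Mf u y) (Nf u y) q.+1 | y <- iota 0 (maxn 1 K)]
            | u <- iota 0 (maxn 1 n)],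
    forall u y, Mf u y 3 = (M 3).+1, forall u y, Nf u y 5 = N 5 &
    forall u y, (u < n)%N -> [/\ between n K (Mf u y), searching G (Mf u y) [:: u],
      Mf u y 4 = 0%N & Nf u y 6 = beta (degree_query G u).+1 y.+1]].
Proof.
move=> beE [bn bK bm] s13.
do 2!eexists; split.
- move=> T avg f; rewrite /= /update /= s13 /= bn bK.
  reflexivity.
- by move=> u y /=; rewrite addn1.
- by [].
move=> u y un.
have vis x : (x < n)%N ->
    ((if (20 + (x + x) == 20 + (u + u))%N then M 12 + 1 else M (20 + (x + x)))
     <= M 12 + 1)%N /\
    ((if (20 + (x + x) == 20 + (u + u))%N then M 12 + 1 else M (20 + (x + x)))
     == M 12 + 1)%N = (x \in [:: u]).
  move=> xn; have le := bm x xn; rewrite inE; case: (eqVneq x u) => [->|xu].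
    by rewrite !eqxx leqnn.
  by skip_updates; split; lia.
split=> //.
- split=> //= x xn; skip_updates; exact: (vis x xn).1.
- split=> //=; rewrite ?un //.
  + by case.
  + by move=> x xn; skip_updates; exact: (vis x xn).2.
  + by rewrite /volume big_nil.
- rewrite /= beE //=.  by rewrite addn1.
Qed.

(** * The main loop *)

Section Loop.
Variables (R : realType) (n : nat) (G : erased_lists n) (K : nat) (be : rexp).
Variable beta : nat -> nat -> R.
Hypothesis n_gt0 : (0 < n)%N.
Hypothesis K_gt0 : (0 < K)%N.
Hypothesis beE : forall (M : nat -> nat) N, M 1 = K -> reval M N be = beta (M 8).+1 (M 5).

Notation deg := (degree_query G).

(** [k] passes, each with one step for the loop test, and a last failing test. *)
Definition loop_fuel (k : nat) : nat := (k * (cost (work_unit be)).+1).+1.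

Lemma loop_fuelS k :
  loop_fuel k.+1 = (cost (work_unit be) + loop_fuel k).+1.
Proof. by rewrite /loop_fuel mulSn; lia. Qed.

Section Run.
Variables (T : Type) (le : T -> T -> Prop) (avg : seq T -> T).
Variables (hval : config R -> T) (bot : T).
Hypothesis ord : outcome_order G le avg hval bot.

Lemma run_loop_exit k (M : nat -> nat) (N : nat -> R) q :
  ~~ beval M N work_left ->
  run G avg hval bot (loop_fuel k) (Config [:: search_loop be] M N q) =
  hval (Config [::] M N q).
Proof.
move=> /negbTE stop; rewrite /loop_fuel (run_While ord) stop.
by case: (k * _)%N.
Qed.

Lemma run_loop_step k (M : nat -> nat) (N : nat -> R) q : beval M N work_left ->
  le (wp G avg (work_unit be)
       (fun M N q => run G avg hval bot (loop_fuel k)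
                         (Config [:: search_loop be] M N q)) M N q)
     (run G avg hval bot (loop_fuel k.+1) (Config [:: search_loop be] M N q)).
Proof. by move=> go; rewrite loop_fuelS (run_While ord) go; exact: (run_wp ord). Qed.

End Run.

Lemma work_leftE (M : nat -> nat) (N : nat -> R) :
  beval M N work_left = (0 < M 0)%N && ~~ (N 5 <= (M 3)%:R).
Proof. by []. Qed.

(** A rejection exhibits a closed proper set, which the first hypothesis forbids when [b] holds;
    each of the at most [k] remaining units adds at most one query. *)
Lemma loop_safe (b : bool) Qmax k (M : nat -> nat) (N : nat -> R) q :
  (b -> forall Q, closed_list G Q -> all (fun x => (x < n)%N) Q -> uniq Q ->
    (0 < size Q < n)%N -> False) ->
  between n K M -> M 13 = 0%N \/ (exists Q, searching G M Q) ->
  N 5 <= (M 3 + k)%:R -> (q + k <= Qmax)%N ->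
  run G (all id) (@safe_end R b Qmax) false (loop_fuel k)
    (Config [:: search_loop be] M N q).
Proof.
move=> nosep; elim: k M N q => [|k IH] M N q bM st Wk qk.
  rewrite (run_loop_exit (safe_order R G b Qmax)); last first.
    by rewrite work_leftE addn0 in Wk *; rewrite Wk andbF.
  by rewrite /safe_end /accepting /= (b_n bM) -lt0n n_gt0 implybT andbT; lia.
case: (boolP (beval M N work_left)) => go; last first.
  rewrite (run_loop_exit (safe_order R G b Qmax)) //.
  by rewrite /safe_end /accepting /= (b_n bM) -lt0n n_gt0 implybT andbT; lia.
apply: (run_loop_step (safe_order R G b Qmax)) => //.
case: st => [s13|[Q sQ]].
  have [Mf [Nf [-> M3 N5 ok]]] := start_search_outcome G N q beE bM s13.
  rewrite all_map; apply/allP => u; rewrite mem_iota /= => un.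
  rewrite all_map; apply/allP => y _ /=.
  have [|b' s' _ _] := ok u y; first by lia.
  apply: IH => //; [by right; exists [:: u] | | by lia].
  by rewrite N5 M3 addSnnS.
have [M' [q' [-> q'q M3 out]]] := search_step_outcome be N q bM sQ.
case: out => [b' s13 _|M0 cl sz|Q' b' s' _ _ _].
- by apply: IH => //; [left | rewrite M3 addSnnS | lia].
- rewrite (run_loop_exit (safe_order R G b Qmax)); last by rewrite work_leftE M0.
  rewrite /safe_end /=; apply/andP; split; first lia.
  apply/implyP => /nosep /(_ Q cl (s_vertices sQ) (s_uniq sQ)) [].
  by rewrite sz (leq_ltn_trans _ (s_done sQ)).
- by apply: IH => //; [right; exists Q' | rewrite M3 addSnnS | lia].
Qed.

Lemma volume_sub Q C : uniq Q -> uniq C -> {subset Q <= C} ->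
  (volume G Q <= volume G C)%N.
Proof.
move=> uQ uC sub; rewrite /volume.
have eqQ : perm_eq Q [seq x <- C | x \in Q].
  apply: uniq_perm; rewrite ?filter_uniq // => x; rewrite mem_filter.
  by case: (boolP (x \in Q)) => //= /sub ->.
by rewrite (perm_big _ eqQ) /= big_filter [leqRHS](bigID (mem Q)) /= leq_addr.
Qed.

(** * Lower bound on the rejection probability of the loop *)

Definition rejects (c : config R) : R := (accepting c == false)%:R.
Definition loop_reject k (M : nat -> nat) (N : nat -> R) q : R :=
  run G (@mean R) rejects 0 (loop_fuel k) (Config [:: search_loop be] M N q).

Lemma reject_order : outcome_order G (fun x y : R => x <= y) (@mean R) rejects 0.
Proof. by apply: mean_order => c; apply: ler0n. Qed.

Lemma loop_reject_step k (M : nat -> nat) N q : beval M N work_left ->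
  wp G (@mean R) (work_unit be) (loop_reject k) M N q <= loop_reject k.+1 M N q.
Proof. exact: (run_loop_step reject_order). Qed.

Lemma mean_mean (a : nat -> nat -> R) :
  mean [seq mean [seq a u y | y <- iota 0 K] | u <- iota 0 n] =
  (\sum_(u <- iota 0 n) \sum_(y <- iota 0 K) a u y) / (n * K)%:R.
Proof.
rewrite /mean big_map !size_map !size_iota natrM invfM.
under eq_bigr => u _ do rewrite big_map size_map size_iota.
by rewrite -mulr_suml mulrAC mulrA.
Qed.

Variables (W p kappa : R) (hit : nat -> nat -> bool).
Hypothesis W_gt0 : 0 < W.
Hypothesis p01 : 0 <= p <= 1.
Hypothesis kappa_ge0 : 0 <= kappa.
Hypothesis beta_ge0 : forall D y, 0 <= beta D y.
Hypothesis hitP : forall u y, (u < n)%N -> hit u y -> exists C : seq nat,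
  [/\ closed_list G C, uniq C, (size C < n)%N, u \in C &
      (volume G C)%:R <= beta (deg u).+1 y.+1].
Hypothesis hit_prob :
  p * (n * K)%:R <= \sum_(u <- iota 0 n) \sum_(y <- iota 0 K) (hit u y)%:R.
(** The 2 pays for the unit that starts the search and for the one that finds the budget
    exceeded. *)
Hypothesis mean_cost :
  \sum_(u <- iota 0 n) \sum_(y <- iota 0 K) (2 + beta (deg u).+1 y.+1)
    <= kappa * (n * K)%:R.

(* The run fails to reject only if the next [j] searches all miss or their cost,
   added to the work [w] done so far, reaches [W]; by Markov's inequality the
   latter has probability at most [(w + j * kappa) / W]. *)
Definition phi (j : nat) (w : R) : R := 1 - (1 - p) ^+ j - (w + j%:R * kappa) / W.

Lemma phi_anti j w w' : w <= w' -> phi j w' <= phi j w.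
Proof.
by move=> ww'; rewrite /phi lerD2l lerN2 ler_wpM2r ?lerD2r // invr_ge0 ltW.
Qed.

Lemma phi_le j w : phi j w <= 1 - w / W.
Proof.
have /andP[p0 p1] := p01.
rewrite /phi mulrDl; have h1 : 0 <= (1 - p) ^+ j by rewrite exprn_ge0 ?subr_ge0.
have : 0 <= j%:R * kappa / W by rewrite divr_ge0 ?mulr_ge0 ?ler0n // ltW.
lra.
Qed.

Lemma loop_reject_ge0 k (M : nat -> nat) N q : 0 <= loop_reject k M N q.
Proof. exact: (outcome_bot reject_order). Qed.

Lemma phi_le_reject j w k (M : nat -> nat) N q : W <= w -> phi j w <= loop_reject k M N q.
Proof.
move=> Ww; apply: le_trans (loop_reject_ge0 _ _ _ _); apply: le_trans (phi_le _ _) _.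
by rewrite subr_le0 ler_pdivlMr // mul1r.
Qed.

Lemma one_sub_le_reject k (M : nat -> nat) N q w : W <= w -> 1 - w / W <= loop_reject k M N q.
Proof.
move=> Ww; apply: le_trans (loop_reject_ge0 _ _ _ _).
by rewrite subr_le0 ler_pdivlMr // mul1r.
Qed.

(** A simultaneous induction on states between searches, in an arbitrary search, and in a search
    confined to a closed proper set that fits the budget. The current search is charged its whole
    budget in advance; in the third case only exhaustion of [W] prevents rejection, so [j]
    disappears. *)
Lemma loop_reject_bounds k (M : nat -> nat) N q :
  between n K M -> N 5 = W -> W <= (M 3 + k)%:R ->
  [/\ M 13 = 0%N -> forall j, phi j (M 3)%:R <= loop_reject k M N q,
      forall Q, searching G M Q -> (M 4)%:R <= N 6 ->
        forall j, phi j ((M 3)%:R - (M 4)%:R + N 6 + 1) <= loop_reject k M N q &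
      forall Q, searching G M Q -> (M 4)%:R <= N 6 ->
        forall C, closed_list G C -> uniq C -> {subset Q <= C} ->
          (size C < n)%N -> (volume G C)%:R <= N 6 ->
        1 - ((M 3)%:R - (M 4)%:R + N 6 + 1) / W <= loop_reject k M N q].
Proof.
elim: k M N q => [|k IH] M N q bM NW; rewrite ?addn0 => Wk.
  split=> [_ j|Q _ zN j|Q _ zN C _ _ _ _ _].
  - exact: phi_le_reject.
  - by apply: phi_le_reject; lra.
  - by apply: one_sub_le_reject; lra.
have [done|go] := leP W (M 3)%:R.
  split=> [_ j|Q _ zN j|Q _ zN C _ _ _ _ _].
  - exact: phi_le_reject.
  - by apply: phi_le_reject; lra.
  - by apply: one_sub_le_reject; lra.
have {go}go : beval M N work_left.
  by rewrite work_leftE (b_n bM) n_gt0 NW -ltNge.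
have g1 (M' : nat -> nat) N' q' : M' 0 = 0%N -> loop_reject k M' N' q' = 1.
  move=> M0; rewrite /loop_reject (run_loop_exit reject_order); last by rewrite work_leftE M0.
  by rewrite /rejects /accepting /= M0.
have W0 := W_gt0.
split.
- move=> s13 [|j].
    apply: le_trans (loop_reject_ge0 _ _ _ _); rewrite /phi expr0 subrr sub0r oppr_le0.
    by rewrite mul0r addr0 divr_ge0 ?ler0n // ltW.
  apply: le_trans (loop_reject_step _ _ go).
  have [Mf [Nf [-> M3 N5 ok]]] := start_search_outcome G N q beE bM s13.
  rewrite (maxn_idPr n_gt0) (maxn_idPr K_gt0) mean_mean.
  rewrite ler_pdivlMr; last by rewrite ltr0n muln_gt0 n_gt0.
  (* On a miss this is [phi j] after the charged search, on a hit at most [1 - w / W] for the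
     charged work [w]; being affine in the budget and the indicator of a hit, it can be averaged. *)
  pose a u y : R := 1 - ((M 3)%:R + j%:R * kappa) / W - (1 - p) ^+ j
     - (2 + beta (deg u).+1 y.+1) / W + (1 - p) ^+ j * (hit u y)%:R.
  have pj0 : 0 <= (1 - p) ^+ j.
    by have /andP[_ p1] := p01; rewrite exprn_ge0 ?subr_ge0.
  have aP u y : (u < n)%N -> (y < K)%N -> a u y <= loop_reject k (Mf u y) (Nf u y) q.+1.
    move=> un yK; have [b' s' M4 N6] := ok u y un.
    have Wk' : W <= (Mf u y 3 + k)%:R by rewrite M3 addSnnS.
    have [_ miss catch] := IH (Mf u y) (Nf u y) q.+1 b' (etrans (N5 _ _) NW) Wk'.
    rewrite M4 M3 N6 subr0 in miss catch.
    have b0 := beta_ge0 (deg u).+1 y.+1.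
    rewrite /a; case hE: (hit u y); last first.
      apply: le_trans (miss _ s' b0 j); rewrite /phi mulr0 addr0 -natr1.
      rewrite le_eqVlt; apply/orP; left; apply/eqP. field. lra.
    have [C [cC uC sC uinC vC]] := hitP un hE.
    apply: le_trans (catch _ s' b0 C cC uC _ sC vC).
      rewrite mulr1 -natr1.
      have : 0 <= j%:R * kappa / W by rewrite divr_ge0 ?mulr_ge0 ?ler0n // ltW.
      rewrite !mulrDl. lra.
    by move=> x; rewrite inE => /eqP ->.
  apply: le_trans (_ : _ <= \sum_(u <- iota 0 n) \sum_(y <- iota 0 K) a u y) _;
    last first.
    rewrite big_seq [leRHS]big_seq; apply: ler_sum => u; rewrite mem_iota => un.
    rewrite big_seq [leRHS]big_seq; apply: ler_sum => y; rewrite mem_iota => yK.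
    exact: aP.
  rewrite /a.
  under eq_bigr => u _ do rewrite big_split /= -mulr_sumr sumrB -mulr_suml
     big_const_seq count_predT size_iota iter_addr_0.
  rewrite big_split /= sumrB -mulr_suml -mulr_sumr big_const_seq count_predT
    size_iota iter_addr_0 -mulrnA.
  rewrite -mulr_natr (mulnC K) /phi exprSr -natr1.
  move: mean_cost hit_prob; set S1 := \sum_(u <- _) _; set S2 := \sum_(u <- _) _.
  set T := (n * K)%:R; set V := W^-1 => cost_le prob_ge.
  (* On average the cost is at most [kappa] and hits have weight at least [p]; the two bounds
     combine to [phi j.+1]. *)
  have hA : S1 * V <= kappa * T * V by rewrite ler_wpM2r // invr_ge0 ltW.
  have hB : (1 - p) ^+ j * (p * T) <= (1 - p) ^+ j * S2 by rewrite ler_wpM2l.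
  lra.
- move=> Q sQ zN j; apply: le_trans (loop_reject_step _ _ go).
  have [M' [q' [-> q'q M3 out]]] := search_step_outcome be N q bM sQ.
  have Wk' : W <= (M' 3 + k)%:R by rewrite M3 addSnnS.
  case: out => [b' s13 _|M0 cl sz|Q' b' s' M4 bud _].
  + have [IH1 _ _] := IH M' N q' b' NW Wk'; apply: le_trans (IH1 s13 j).
    by apply: phi_anti; rewrite M3 -natr1; lra.
  + rewrite g1 //; apply: le_trans (phi_le _ _) _; rewrite gerBl divr_ge0 ?(ltW W0) //.
    have := ler0n R (M 3); lra.
  + have [_ IH2 _] := IH M' N q' b' NW Wk'; rewrite -M4 in bud.
    apply: le_trans (IH2 _ s' bud j); apply: phi_anti; rewrite M3 M4 -!natr1; lra.
move=> Q sQ zN C cC uC QC sC vC; apply: le_trans (loop_reject_step _ _ go).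
have [M' [q' [-> q'q M3 out]]] := search_step_outcome be N q bM sQ.
have Wk' : W <= (M' 3 + k)%:R by rewrite M3 addSnnS.
case: out => [b' s13 reason|M0 cl sz|Q' b' s' M4 bud QQ'].
(* None of the three reasons is possible: [C] fits the budget, is closed, and is smaller than the
   vertex set. *)
- case: reason => [ov|[v [i [vQ iv n0]]]|[_ nQ]].
  + suff : ((M 4).+1 <= volume G C)%N by rewrite -(ler_nat R) => ?; exfalso; lra.
    apply: leq_trans (_ : volume G (take (M 10).+1 Q) <= _)%N; last first.
      by apply: volume_sub; rewrite ?take_uniq ?(s_uniq sQ) // => x /mem_take /QC.
    rewrite (take_nth 0%N (s_done sQ)) /volume big_rcons /= (s_work sQ) ltn_add2l ltnS.
    by rewrite -(s_current sQ) -(s_degree sQ) (s_position sQ).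
  + by have := cC v i (QC _ vQ) iv; rewrite /entry_in n0.
  + by have := leq_trans nQ (uniq_leq_size (s_uniq sQ) QC); rewrite leqNgt sC.
- rewrite g1 // gerBl divr_ge0 ?(ltW W0) //.
  have := ler0n R (M 3); lra.
- have [_ _ IH3] := IH M' N q' b' NW Wk'; rewrite -M4 in bud.
  (* A new vertex is an entry of a vertex of the closed list [C]. *)
  have {}QC : {subset Q' <= C}.
    case: QQ' => [->|[v [i [vQ iv nb ->]]]] // x; rewrite mem_rcons inE.
    case/orP=> [/eqP->|/QC //].
    by have := cC v i (QC _ vQ) iv; rewrite /entry_in nb.
  apply: le_trans (IH3 _ s' bud C cC uC QC sC vC).
  by rewrite M3 M4 lerD2l lerN2 ler_wpM2r ?invr_ge0 ?(ltW W0) // -!natr1; lra.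
Qed.

(** By induction from [(1 - x) * (1 + (j + 1) * x) <= 1 + j * x]; it bounds [(1 - p) ^+ j] by
    [1 / (1 + j * p)] without exponentials. *)
Lemma exprn_bernoulli (x : R) j : 0 <= x <= 1 -> (1 - x) ^+ j * (1 + j%:R * x) <= 1.
Proof.
case/andP=> x0 x1; elim: j => [|j IH]; first by rewrite expr0 mul0r addr0 mulr1.
apply: le_trans IH; rewrite exprSr -natr1.
have : 0 <= (1 - x) ^+ j * (x * x) by rewrite mulr_ge0 ?mulr_ge0 ?exprn_ge0 ?subr_ge0.
have : 0 <= (1 - x) ^+ j * (x * x) * j%:R.
  by rewrite mulr_ge0 ?mulr_ge0 ?exprn_ge0 ?subr_ge0.
nra.
Qed.

(* With about [5 / p] searches, both terms that [phi] subtracts are at most 1/6. *)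
Lemma loop_reject_ge k (M : nat -> nat) N q : 0 < p -> 36 * kappa <= p * W ->
  between n K M -> M 13 = 0%N -> M 3 = 0%N -> N 5 = W -> W <= k%:R ->
  2 / 3 <= loop_reject k M N q.
Proof.
move=> p0 Wbig bM s13 M3 NW Wk; have /andP[_ p1] := p01.
have [|start _ _] := loop_reject_bounds q bM NW (k := k); first by rewrite M3.
pose j := (Num.truncn (5 / p)).+1; apply: le_trans (start s13 j).
have j5 : 5 <= j%:R * p by rewrite -ler_pdivrMr // ltW // /j truncnS_gt.
(* Rounding up [5 / p] adds at most [p <= 1] to the product. *)
have j6 : j%:R * p <= 6.
  have : (Num.truncn (5 / p))%:R * p <= 5.
    by rewrite -ler_pdivlMr // truncn_le // divr_ge0 // ltW.
  by rewrite /j -natr1; lra.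
rewrite /phi M3 add0r.
have miss : (1 - p) ^+ j <= 1 / 6.
  have := exprn_bernoulli j p01; have : 0 <= (1 - p) ^+ j.
    by rewrite exprn_ge0 ?subr_ge0.
  nra.
(* The constant [36] is chosen so that [j * p <= 6] leaves [6 / 36]. *)
have : j%:R * kappa / W <= 1 / 6.
  rewrite ler_pdivrMr //; have j0 := ler0n R j; have k0 := kappa_ge0.
  rewrite -(ler_pM2l p0); nra.
lra.
Qed.

End Loop.

(** * Components of a completion *)

Section Completion.
Variables (R : realType) (n : nat) (G : erased_lists n) (E : {set {set 'I_n}}).
Hypothesis cE : completion G E.

Lemma list_of_ord (u : 'I_n) : list_of G u = G u.
Proof. by rewrite /list_of valK. Qed.

Lemma degree_query_ord (u : 'I_n) : degree_query G u = size (G u).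
Proof. by rewrite /degree_query list_of_ord. Qed.

Lemma size_list (u : 'I_n) : size (G u) = #|[set v | adjacent E u v]|.
Proof.
have [_ [L [/(_ u)[uL LE] /(_ u)]]] := cE.
rewrite all2E => /andP[/eqP -> _]; rewrite -(card_uniqP uL) cardsE.
by apply: eq_card => v; rewrite LE.
Qed.

Lemma entry_adjacent (u v : 'I_n) i :
  (i < size (G u))%N -> nth None (G u) i = Some v -> adjacent E u v.
Proof.
have [_ [L [/(_ u)[uL LE] /(_ u)]]] := cE.
rewrite all2E => /andP[/eqP sz al] iu nv.
have iL : (i < size (L u))%N by rewrite -sz.
have -> : adjacent E u v = (v \in L u) by rewrite LE.
have := all_nthP (None, v) al i; rewrite size_zip -sz minnn => /(_ iu).
by rewrite nth_zip //= nv /= => /eqP[->]; rewrite mem_nth.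
Qed.

Lemma adjacent_entry (u v : 'I_n) : adjacent E u v -> exists i,
  (i < size (G u))%N /\ (nth None (G u) i = None \/ nth None (G u) i = Some v).
Proof.
have [_ [L [/(_ u)[uL LE] /(_ u)]]] := cE.
rewrite all2E => /andP[/eqP sz al] uv.
have vL : v \in L u by rewrite LE.
have iL : (index v (L u) < size (G u))%N by rewrite sz index_mem.
exists (index v (L u)); split=> //.
have := all_nthP (None, v) al (index v (L u)); rewrite size_zip -sz minnn => /(_ iL).
by rewrite nth_zip //= nth_index // => /orP[] /eqP; [left | right].
Qed.

Lemma adjacent_sym : symmetric (adjacent E).
Proof. by move=> u v; rewrite /adjacent setUC. Qed.

Lemma adjacent_irr u : adjacent E u u = false.
Proof.
by have [sE _] := cE; apply/negP => /sE; rewrite setUid cards1.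
Qed.

Lemma adjacent_connect_sym : connect_sym (adjacent E).
Proof. exact/sym_connect_sym/adjacent_sym. Qed.

Lemma handshake : (\sum_(u < n) size (G u) = #|E|.*2)%N.
Proof.
have [sE _] := cE.
under eq_bigr => u _ do rewrite size_list.
transitivity (\sum_(u : 'I_n) \sum_(e in E) (u \in e : nat))%N.
  apply: eq_bigr => u _; rewrite -big_mkcondr /= sum1_card.
  (* Neighbours of [u] correspond to edges at [u]; the map is injective on them because there are no
     loops. *)
  rewrite -(card_in_imset (f := fun v => [set u; v])); last first.
    move=> v w; rewrite !inE => uv uw /setP/(_ v); rewrite !inE eqxx orbT.
    by case/esym/orP=> /eqP // vu; rewrite vu adjacent_irr in uv.
  apply: eq_card => e; apply/imsetP/andP => [[v]|[eE ue]].
    by rewrite inE => uv ->; rewrite set21.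
  have /cards2P[a [b [ab eab]]] : #|e| == 2%N by rewrite sE.
  move: ue; rewrite eab !inE => /orP[] /eqP ->.
    by exists b => //; rewrite inE /adjacent -eab.
  by exists a; rewrite ?inE /adjacent setUC -?eab.
rewrite exchange_big /= -muln2 -sum_nat_const; apply: eq_bigr => e eE.
by rewrite -big_mkcond /= sum1_card sE.
Qed.

Lemma num_edgesE : num_edges R G = #|E|%:R.
Proof. by rewrite /num_edges handshake -muln2 natrM mulfK ?pnatr_eq0. Qed.

(** All entries of a closed list are present and stay inside it, so a path of the completion cannot
    leave it. *)
Lemma closed_not_separating Q : connected_graph E -> closed_list G Q ->
  all (fun x => (x < n)%N) Q -> uniq Q -> (0 < size Q < n)%N -> False.
Proof.
move=> conn cQ Qn uQ /andP[Q0 Qlt].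
have [x xQ] : exists x, x \in Q.
  by case: Q Q0 {cQ Qn uQ Qlt} => // x Q _; exists x; rewrite mem_head.
have stay (u v : 'I_n) : connect (adjacent E) u v -> val u \in Q -> val v \in Q.
  case/connectP => p; elim: p u => [u _ -> //|w p IH u /= /andP[uw pw] vE uQ'].
  apply: IH pw vE _; have [i [iu ent]] := adjacent_entry uw.
  have := cQ _ i uQ'; rewrite degree_query_ord => /(_ iu).
  by rewrite /entry_in /neighbor_query list_of_ord; case: ent => ->.
have xn : (x < n)%N by move/allP: Qn; apply.
have : (n <= size Q)%N.
  rewrite -(size_iota 0 n); apply: uniq_leq_size (iota_uniq 0 n) _ => y.
  by rewrite mem_iota => yn; apply: (stay (Ordinal xn) (Ordinal yn)).
by rewrite leqNgt Qlt.
Qed.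

Lemma connected_size : connected_graph E -> (1 < n)%N ->
  (n <= \sum_(u < n) size (G u))%N.
Proof.
move=> conn n1; rewrite -[n in (n <= _)%N]card_ord -sum1_card; apply: leq_sum => u _.
rewrite size_list card_gt0; apply/set0Pn.
have [v vu] : exists v : 'I_n, v != u.
  have n0 := ltnW n1.
  case: (eqVneq (val u) 0%N) => u0; [exists (Ordinal n1)|exists (Ordinal n0)].
    by rewrite -val_eqE /= u0.
  by rewrite -val_eqE /= eq_sym.
have /connectP[[|w p] /= pth vE] := conn u v; first by rewrite vE eqxx in vu.
by exists w; rewrite inE; case/andP: pth.
Qed.

Definition components : {set 'I_n} := [set r | fingraph.root (adjacent E) r == r].

Definition unerased_component (u : 'I_n) : bool :=
  [forall v, connect (adjacent E) u v ==> (None \notin G v)].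

Definition component_list (u : 'I_n) : seq nat :=
  [seq val v | v in connect (adjacent E) u].

Definition unerased_components : {set 'I_n} :=
  [set r in components | unerased_component r].

Lemma unerased_component_connect u v :
  connect (adjacent E) u v -> unerased_component u = unerased_component v.
Proof.
by move=> uv; apply: eq_forallb => w; rewrite (same_connect adjacent_connect_sym uv).
Qed.

(** Joining a fixed representative to those of all other components connects the graph at the cost
    of one edge fewer than there are components. *)
Lemma far_components (eps : R) : (0 < n)%N -> far_from_connectedness eps G ->
  eps * num_edges R G + 1 <= #|components|%:R.
Proof.
move=> n0 far; have [sE _] := cE; have csym := adjacent_connect_sym.
pose r0 := fingraph.root (adjacent E) (Ordinal n0).
have r0c : r0 \in components by rewrite inE root_root.
pose E' := E :|: [set [set r0; r] | r in components :\ r0].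
have sub : subrel (adjacent E) (connect (adjacent E')).
  by move=> u v uv; apply: connect1; rewrite /adjacent inE [_ \in E]uv.
have to_r0 v : connect (adjacent E') v r0.
  have vr : connect (adjacent E') v (fingraph.root (adjacent E) v).
    exact/(connect_sub sub)/connect_root.
  case: (eqVneq (fingraph.root (adjacent E) v) r0) => [<- //|ne].
  apply: connect_trans vr _; apply: connect1.
  rewrite /adjacent inE setUC; apply/orP; right; apply/imsetP.
  by exists (fingraph.root (adjacent E) v); rewrite // !inE ne root_root // eqxx.
have sE' : simple_graph E'.
  move=> e; rewrite inE => /orP[/sE //|/imsetP[r]].
  by rewrite !inE => /andP[ne _] ->; rewrite cards2 eq_sym ne.
have csym' : connect_sym (adjacent E').
  by apply: sym_connect_sym => u v; rewrite /adjacent setUC.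
have conn' : connected_graph E'.
  by move=> u v; apply: connect_trans (to_r0 u) _; rewrite csym'.
apply: le_trans (_ : (edge_distance E E')%:R + 1 <= _).
  by rewrite lerD2r; apply: far.
rewrite natr1 ler_nat (cardsD1 r0) r0c add1n ltnS.
apply: leq_trans (leq_imset_card (fun r => [set r0; r]) _); apply: subset_leq_card.
apply/subsetP => e; rewrite !inE.
by case: (e \in E); rewrite /= ?andbF ?andbT ?orbF.
Qed.

(** Every component that is not unerased is the component of a vertex whose list has an erased
    entry. *)
Lemma erased_components_le : (#|components| <= #|unerased_components| + num_erased G)%N.
Proof.
rewrite -(cardsID unerased_components components) leq_add //.
  by apply: subset_leq_card; apply: subsetIr.
pose bad := [set v : 'I_n | None \in G v].
apply: leq_trans (_ : #|[set fingraph.root (adjacent E) v | v in bad]| <= _)%N.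
  apply: subset_leq_card; apply/subsetP => r; rewrite !inE.
  case/andP=> /nandP[/negbTE->|] // + rr; rewrite negb_forall => /existsP[v].
  rewrite negb_imply negbK => /andP[rv bv]; apply/imsetP; exists v; rewrite ?inE //.
  by rewrite -(eqP rr); apply/(fingraph.rootP adjacent_connect_sym).
apply: leq_trans (leq_imset_card _ _) _.
rewrite /num_erased -sum1_card [leqRHS](bigID (mem bad)) /=.
apply: leq_trans (leq_addr _ _); apply: leq_sum => v; rewrite inE => bv.
by rewrite -has_count has_pred1.
Qed.

(** An isolated vertex forms an unerased component, and every other vertex has a nonempty list. This
    serves sparse graphs, where farness alone gives too few components. *)
Lemma isolated_unerased :
  (n <= #|unerased_components| + \sum_(u < n) size (G u))%N.
Proof.
pose iso := [set u : 'I_n | size (G u) == 0%N].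
have isoS : iso \subset unerased_components.
  apply/subsetP => u; rewrite inE => /eqP u0.
  have alone v : connect (adjacent E) u v -> v = u.
    case/connectP => -[//|w p] /= /andP[uw _]; have [i [iu _]] := adjacent_entry uw.
    by rewrite u0 in iu.
  rewrite !inE (alone _ (connect_root _ _)) eqxx /=; apply/forallP => v.
  by apply/implyP => /alone ->; rewrite (size0nil u0).
rewrite -{1}(card_ord n) -(cardsT 'I_n) -(cardsID iso setT) setTI leq_add //.
  exact: subset_leq_card.
rewrite setTD -sum1_card [leqRHS](bigID (mem (~: iso))) /=.
by apply: leq_trans (leq_addr _ _); apply: leq_sum => u; rewrite !inE lt0n.
Qed.

Lemma mem_component_list u (v : 'I_n) :
  (val v \in component_list u) = connect (adjacent E) u v.
Proof. by rewrite mem_map ?mem_enum //; apply: val_inj. Qed.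

Lemma component_list_closed u :
  unerased_component u -> closed_list G (component_list u).
Proof.
move=> /forallP good x i /mapP[v]; rewrite mem_enum => uv ->.
rewrite degree_query_ord /entry_in /neighbor_query list_of_ord => iv.
have := good v; rewrite [connect _ _ _]uv /= => noN.
case vw: nth => [w|]; last by rewrite -vw mem_nth in noN.
rewrite /= mem_component_list; apply: connect_trans uv _.
exact/connect1/(entry_adjacent iv).
Qed.

Lemma component_list_size u : ~ connected_graph E -> (size (component_list u) < n)%N.
Proof.
move=> nconn; rewrite size_map -cardE ltnNge; apply/negP => full.
apply: nconn; have all_u v : connect (adjacent E) u v.
  have /setP/(_ v) : [set v | connect (adjacent E) u v] = setT.
    by apply/eqP; rewrite eqEcard subsetT cardsT card_ord cardsE.
  by rewrite !inE.
by move=> v w; apply: connect_trans (all_u w); rewrite adjacent_connect_sym.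
Qed.

End Completion.

(** * Success probability and cost of a search *)

Definition component_budget : rexp :=
  RDiv (RMul (ROfInt (IAdd (cell 8) (ICst 1))) (ROfInt (cell 1))) (ROfInt (cell 5)).

Definition square_budget : rexp :=
  RDiv (RMul (ROfInt (cell 1)) (ROfInt (cell 1)))
       (RMul (ROfInt (cell 5)) (ROfInt (cell 5))).

Section Counting.
Variables (R : realType) (n : nat) (G : erased_lists n) (E : {set {set 'I_n}}).
Hypothesis cE : completion G E.
Variable K : nat.

Lemma sum_iota_ord m (F : nat -> R) : \sum_(u <- iota 0 m) F u = \sum_(u < m) F u.
Proof. by rewrite -(big_mkord xpredT F) /index_iota subn0. Qed.

(** The integer part of [K * theta] counts such draws, and rounding loses less than 1. *)
Lemma count_below (theta : R) : 0 <= theta <= 1 ->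
  K%:R * theta - 1 <= \sum_(y <- iota 0 K) ((y.+1%:R <= K%:R * theta)%R)%:R.
Proof.
case/andP=> t0 t1; have Kt0 : 0 <= K%:R * theta by rewrite mulr_ge0.
pose f := Num.truncn (K%:R * theta).
have fK : (f <= K)%N.
  rewrite -(ler_nat R) (le_trans (_ : _ <= K%:R * theta)) ?truncn_le //.
  by rewrite ler_piMr.
rewrite -(subnKC fK) iotaD big_cat /= subnKC //.
rewrite (eq_big_seq (fun=> 1)) => [|y]; last first.
  rewrite mem_iota add0n => /= yf; rewrite (_ : (_ <= _)) //.
  by rewrite -truncn_ge_nat.
rewrite big_const_seq count_predT size_iota iter_addr_0 -lerBlDl.
apply: le_trans (_ : 0 <= _); last by apply: sumr_ge0.
by rewrite subr_le0 lerBlDr natr1 ltW // truncnS_gt.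
Qed.

Definition hit (beta : nat -> nat -> R) (u y : nat) : bool :=
  if insub u is Some o then
    unerased_component G E o &&
      ((volume G (component_list E o))%:R <= beta (degree_query G u).+1 y.+1)
  else false.

Lemma hit_closed_list beta u y : ~ connected_graph E ->
  (u < n)%N -> hit beta u y -> exists C : seq nat,
  [/\ closed_list G C, uniq C, (size C < n)%N, u \in C &
      (volume G C)%:R <= beta (degree_query G u).+1 y.+1].
Proof.
move=> nconn un; rewrite /hit insubT => /andP[good vol].
exists (component_list E (Sub u un)); split=> //.
- exact: component_list_closed.
- by rewrite map_inj_uniq ?enum_uniq //; apply: val_inj.
- exact: component_list_size.
- by have := mem_component_list E (Sub u un) (Sub u un); rewrite SubK connect0.
Qed.

(** [theta u] is a share of draws that suffice at [u]. The shares over a component add up to 1, and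
    rounding loses at most 1 for each of the [n] vertices. *)
Lemma hit_count beta (theta : 'I_n -> R) :
  (forall u, 0 <= theta u <= 1) ->
  (forall (u : 'I_n) y, (y.+1%:R <= K%:R * theta u) ->
    (volume G (component_list E u))%:R <= beta (degree_query G u).+1 y.+1) ->
  (forall r, \sum_(u | connect (adjacent E) r u) theta u = 1) ->
  K%:R * #|unerased_components G E|%:R - n%:R <=
    \sum_(u <- iota 0 n) \sum_(y <- iota 0 K) (hit beta u y)%:R :> R.
Proof.
move=> theta01 enough theta_sum; have csym := @adjacent_connect_sym n E.
rewrite sum_iota_ord (bigID (unerased_component G E)) /= -[leLHS]addr0.
apply: lerD; last by apply: sumr_ge0 => u _; apply: sumr_ge0.
apply: le_trans (_ : \sum_(u | unerased_component G E u) (K%:R * theta u - 1) <= _).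
  rewrite sumrB -mulr_sumr sumr_const lerB //; last first.
    by rewrite ler_nat -[leqRHS]card_ord max_card.
  rewrite ler_wpM2l // (partition_big (fingraph.root (adjacent E))
    (mem (unerased_components G E))) /=; last first.
    move=> u gu; rewrite !inE root_root // eqxx /=.
    by rewrite -(unerased_component_connect G (connect_root _ u)).
  rewrite -sum1_card natr_sum; apply: ler_sum => r; rewrite !inE => /andP[/eqP rr gr].
  rewrite mulr1n -(theta_sum r) le_eqVlt; apply/orP; left; apply/eqP; apply: eq_bigl => u.
  rewrite -[X in _ == X]rr (root_connect csym) csym; case: (boolP (connect (adjacent E) u r)) => ru;
    rewrite ?andbF ?andbT //.
  by rewrite (unerased_component_connect G ru) gr.
apply: ler_sum => u gu; apply: le_trans (count_below (theta01 u)) _.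
apply: ler_sum => y _; rewrite ler_nat /hit valK gu /=.
by case: (boolP (_ <= K%:R * _)) => // /enough ->.
Qed.

Lemma volume_component u : volume G (component_list E u) =
  (\sum_(v | connect (adjacent E) u v) (size (G v)).+1)%N.
Proof.
rewrite /volume big_map big_enum_cond /=; apply: eq_big => [v|v _].
  by rewrite andbT.
by rewrite degree_query_ord.
Qed.

Lemma connect_card u v : connect (adjacent E) u v ->
  #|connect (adjacent E) v| = #|connect (adjacent E) u|.
Proof.
have csym := @adjacent_connect_sym n E.
by move=> uv; apply: eq_card => w; rewrite -!topredE /= (same_connect csym uv).
Qed.

Lemma size_lt_component u : (size (G u) < #|connect (adjacent E) u|)%N.
Proof.
have uu : u \in connect (adjacent E) u by apply: connect0.
rewrite (size_list cE) [ltnRHS](cardD1 u) uu add1n ltnS.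
apply: subset_leq_card; apply/subsetP => v; rewrite !inE => uv.
rewrite connect1 // andbT; apply/eqP => vu.
by rewrite vu (adjacent_irr cE) in uv.
Qed.

Definition component_beta (D y : nat) : R := D%:R * K%:R / y%:R.
Definition square_beta (_ y : nat) : R := K%:R * K%:R / (y%:R * y%:R).

(** The share of [u] is [(deg u + 1) / vol C], and [vol C] is the sum of these numerators. *)
Lemma component_hits :
  K%:R * #|unerased_components G E|%:R - n%:R <=
    \sum_(u <- iota 0 n) \sum_(y <- iota 0 K) (hit component_beta u y)%:R :> R.
Proof.
have csym := @adjacent_connect_sym n E.
have vol0 u : 0 < (volume G (component_list E u))%:R :> R.
  by rewrite ltr0n volume_component (bigD1 u) ?connect0.
apply: (@hit_count _ (fun u => (size (G u)).+1%:R /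
   (volume G (component_list E u))%:R)) => [u|u y|r].
- rewrite divr_ge0 //= ler_pdivrMr // mul1r ler_nat volume_component.
  by rewrite (bigD1 u) ?connect0 //= leq_addr.
- rewrite /component_beta degree_query_ord mulrA ler_pdivlMr // => h.
  by rewrite ler_pdivlMr ?ltr0n // mulrC [_ * K%:R]mulrC.
have volr u : connect (adjacent E) r u ->
    volume G (component_list E u) = volume G (component_list E r).
  move=> ru; rewrite !volume_component; apply: eq_bigl => w.
  by rewrite (same_connect csym ru).
rewrite (eq_bigr (fun u => (size (G u)).+1%:R /
   (volume G (component_list E r))%:R)) => [|u /volr -> //].
by rewrite -mulr_suml -natr_sum -volume_component divff // gt_eqF.
Qed.

(** The share is [1 / |C|]: degrees in [C] are below [|C|], so [vol C <= |C| ^ 2], and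
    [y <= K / |C|] makes the budget [(K / y) ^ 2] at least that. *)
Lemma square_hits :
  K%:R * #|unerased_components G E|%:R - n%:R <=
    \sum_(u <- iota 0 n) \sum_(y <- iota 0 K) (hit square_beta u y)%:R :> R.
Proof.
have c0 u : (0 < #|connect (adjacent E) u|)%N.
  exact: leq_ltn_trans (size_lt_component u).
apply: (@hit_count _ (fun u => #|connect (adjacent E) u|%:R^-1)) => [u|u y|r].
- by rewrite invr_ge0 ler0n invf_le1 ?ltr0n // ler1n c0.
- rewrite ler_pdivlMr ?ltr0n // => h.
  have vol : (volume G (component_list E u) <=
      #|connect (adjacent E) u| * #|connect (adjacent E) u|)%N.
    rewrite volume_component -sum_nat_const; apply: leq_sum => v uv.
    by rewrite -(connect_card uv) size_lt_component.
  rewrite /square_beta ler_pdivlMr ?mulr_gt0 ?ltr0n //.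
  apply: le_trans (_ : (#|connect (adjacent E) u| * #|connect (adjacent E) u|)%:R *
    (y.+1%:R * y.+1%:R) <= _); first by rewrite ler_wpM2r ?ler_nat ?mulr_ge0.
  by rewrite natrM mulrACA [_%:R * y.+1%:R]mulrC ler_pM ?mulr_ge0.
rewrite (eq_bigr (fun=> #|connect (adjacent E) r|%:R^-1)) => [|u ru].
  by rewrite sumr_const -[LHS]mulr_natl; apply: divff; rewrite pnatr_eq0 -lt0n; apply: c0.
by rewrite (connect_card ru).
Qed.

End Counting.

(** * Average cost of a search *)

Lemma harmonic_le (R : realType) J :
  \sum_(y <- iota 0 (2 ^ J)) (y.+1%:R : R)^-1 <= J.+1%:R.
Proof.
elim: J => [|J IH]; first by rewrite big_seq1 invr1.
rewrite expnS mul2n -addnn iotaD big_cat /= -natr1 lerD //.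
(* The second half consists of [2 ^ J] terms, each at most the inverse of [2 ^ J]. *)
apply: le_trans (_ : \sum_(y <- iota (2 ^ J) (2 ^ J)) ((2 ^ J)%:R : R)^-1 <= _).
  rewrite big_seq [leRHS]big_seq; apply: ler_sum => y; rewrite mem_iota => /andP[Ky _].
  by rewrite lef_pV2 ?posrE ?ltr0n ?expn_gt0 // ler_nat ltnW.
rewrite big_const_seq count_predT size_iota iter_addr_0 -[leLHS]mulr_natl divff //.
by rewrite pnatr_eq0 expn_eq0.
Qed.

Lemma sum_inv_squares_le (R : realType) k :
  \sum_(y <- iota 0 k) ((y.+1%:R * y.+1%:R : R)^-1) <= 2.
Proof.
(* Subtracting [1 / (j + 1)] strengthens the bound so that it telescopes. *)
suff H j : \sum_(y <- iota 0 j.+1) ((y.+1%:R * y.+1%:R : R)^-1) <= 2 - j.+1%:R^-1.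
  case: k => [|k]; first by rewrite big_nil.
  by apply: le_trans (H k) _; rewrite gerBl invr_ge0.
elim: j => [|j IH]; first by rewrite big_seq1 mulr1 invr1; lra.
rewrite -addn1 iotaD big_cat big_seq1 add0n.
apply: le_trans (lerD IH (lexx _)) _; rewrite addn1.
have j0 : 0 < j.+1%:R :> R by rewrite ltr0n.
rewrite -[j.+2%:R]natr1; set a := j.+1%:R in j0 *.
rewrite -subr_ge0 (_ : _ - _ = (a * (a + 1) * (a + 1))^-1); last by field; lra.
by rewrite invr_ge0 !mulr_ge0 //; lra.
Qed.

Section Costs.
Variables (R : realType) (n : nat) (G : erased_lists n) (K : nat).

Lemma component_cost J : K = (2 ^ J)%N ->
  \sum_(u <- iota 0 n) \sum_(y <- iota 0 K)
     (2 + component_beta R K (degree_query G u).+1 y.+1) <=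
  3 * (2 * num_edges R G + n%:R) * J.+1%:R * K%:R.
Proof.
move=> KJ; rewrite sum_iota_ord.
apply: le_trans (_ : \sum_(u < n) (size (G u)).+1%:R * (3 * K%:R * J.+1%:R) <= _).
  apply: ler_sum => u _.
  apply: le_trans (_ : \sum_(y <- iota 0 K) (size (G u)).+1%:R * (3 * K%:R) * y.+1%:R^-1 <= _).
    rewrite big_seq [leRHS]big_seq; apply: ler_sum => y; rewrite mem_iota => /andP[_ yK].
    rewrite /component_beta degree_query_ord.
    (* As [y <= K], the budget is at least 1, so adding 2 at most triples it. *)
    have : 1 <= (size (G u)).+1%:R * K%:R / y.+1%:R :> R.
      rewrite ler_pdivlMr ?ltr0n // mul1r -natrM ler_nat.
      by rewrite (leq_trans yK) // leq_pmull.
    move: (y.+1%:R^-1) => v; lra.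
  by rewrite -mulr_sumr [leRHS]mulrA ler_wpM2l ?mulr_ge0 // KJ harmonic_le.
rewrite -mulr_suml; under eq_bigr => u _ do rewrite -natr1.
rewrite big_split /= sumr_const card_ord -natr_sum.
rewrite /num_edges; set S := (\sum_(_ < _) _)%:R.
by rewrite (_ : 2 * (S / 2) = S) ?lexx; [lra|field].
Qed.

Lemma square_cost : (0 < K)%N ->
  \sum_(u <- iota 0 n) \sum_(y <- iota 0 K)
     (2 + square_beta R K (degree_query G u).+1 y.+1) <=
  6 * K%:R * (n * K)%:R.
Proof.
move=> K0; rewrite natrM.
apply: le_trans (_ : \sum_(u <- iota 0 n) 6 * (K%:R * K%:R) <= _); last first.
  rewrite big_const_seq count_predT size_iota iter_addr_0 -[leLHS]mulr_natl; lra.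
apply: ler_sum => u _.
apply: le_trans (_ : \sum_(y <- iota 0 K) 3 * (K%:R * K%:R) * (y.+1%:R * y.+1%:R)^-1 <= _).
  rewrite big_seq [leRHS]big_seq; apply: ler_sum => y; rewrite mem_iota => /andP[_ yK].
  rewrite /square_beta.
  have : 1 <= K%:R * K%:R / (y.+1%:R * y.+1%:R) :> R.
    rewrite ler_pdivlMr ?mulr_gt0 ?ltr0n // mul1r ler_pM // ler_nat; exact: yK.
  move: ((y.+1%:R * y.+1%:R)^-1) => v; lra.
rewrite -mulr_sumr; have := sum_inv_squares_le R K.
have : 0 <= 3 * (K%:R * K%:R) :> R by rewrite !mulr_ge0.
nra.
Qed.

End Costs.

(** * The two testers *)

(** Programs cannot round, so a power of two that is at least register 8 is found by doubling; cell
    2 counts the doublings and ends up as its logarithm. *)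
Definition doubling : prog :=
  While (BNot (BRle (RReg 8) (ROfInt (cell 1))))
    (blk [:: IStore (ICst 1) (IAdd (cell 1) (cell 1));
             IStore (ICst 2) (IAdd (cell 2) (ICst 1))]).

Lemma doubling_run (R : realType) n (G : erased_lists n) (M : nat -> nat)
    (N : nat -> R) q :
  M 1%N = 1%N -> M 2%N = 0%N -> 1 < N 8%N -> exists J M',
  [/\ N 8%N <= (2 ^ J)%:R < 2 * N 8%N, M' 1%N = (2 ^ J)%N, M' 2%N = J,
      forall a, a != 1%N -> a != 2%N -> M' a = M a &
      forall (T : Type) (le : T -> T -> Prop) avg hval bot,
        outcome_order G le avg hval bot -> forall s t,
        le (run G avg hval bot t (Config s M' N q))
           (run G avg hval bot (6 * J + 1 + t) (Config (doubling :: s) M N q))].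
Proof.
move=> M1 M2 N1.
have exJ : exists J, N 8%N <= (2 ^ J)%:R.
  exists (Num.truncn (N 8%N)).+1; apply: le_trans (ltW (truncnS_gt _)) _.
  by rewrite ler_nat ltnW // ltn_expl.
have [J NJ minJ] := ex_minnP exJ; exists J.
have small j : (j < J)%N -> (2 ^ j)%:R < N 8%N.
  by move=> jJ; rewrite ltNge; apply: contraL jJ => /minJ; rewrite -leqNgt.
(* By minimality half the power is too small; for [J = 0] the assumption [1 < N 8] is used. *)
have J2 : (2 ^ J)%:R < 2 * N 8%N.
  case: J NJ minJ small => [|J] _ _ small; first by rewrite expn0; lra.
  by rewrite expnS natrM ltr_pM2l // small.
have H d : forall j (M : nat -> nat), (j + d)%N = J -> M 1%N = (2 ^ j)%N ->
    M 2%N = j -> exists M' : nat -> nat,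
  [/\ M' 1%N = (2 ^ J)%N, M' 2%N = J,
      forall a, a != 1%N -> a != 2%N -> M' a = M a &
      forall (T : Type) (le : T -> T -> Prop) avg hval bot,
        outcome_order G le avg hval bot -> forall s t,
        le (run G avg hval bot t (Config s M' N q))
           (run G avg hval bot (6 * d + 1 + t) (Config (doubling :: s) M N q))].
  elim: d => [|d IH] j M0 jd Mj Mc.
    exists M0; rewrite addn0 in jd; split; rewrite -?jd // => T le avg hval bot ord s t.
    rewrite muln0 add0n add1n /doubling (run_While ord) /= Mj jd NJ.
    exact: outcome_refl ord _.
  have [|||M' [M'1 M'2 M'a M'run]] :=
    IH j.+1 (update (update M0 1 (M0 1 + M0 1)%N) 2 (M0 2 + 1)%N).
  - by rewrite addSnnS.
  - by rewrite /update /= Mj addnn -mul2n -expnS.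
  - by rewrite /update /= Mc addn1.
  exists M'; split=> // [a a1 a2|T le avg hval bot ord s t].
    by rewrite M'a // /update (negbTE a1) (negbTE a2).
  apply: (outcome_trans ord) (M'run T le avg hval bot ord s t) _.
  (* An iteration takes one step for the test and 5 for the body. *)
  rewrite (_ : (6 * d.+1 + 1 + t = (5 + (6 * d + 1 + t)).+1)%N); last by lia.
  have more : beval M0 N (BNot (BRle (RReg 8) (ROfInt (cell 1)))).
    by rewrite /= Mj -ltNge small // -jd; lia.
  rewrite /doubling (run_While ord) more.
  exact: (@run_wp R n G T le avg hval bot ord (6 * d + 1 + t)
    (blk [:: IStore (ICst 1) (IAdd (cell 1) (cell 1));
             IStore (ICst 2) (IAdd (cell 2) (ICst 1))]) (doubling :: s) M0 N q).
have [|||M' [h1 h2 h3 h4]] := H J 0%N M; rewrite ?add0n //.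
by exists M'; split=> //; rewrite NJ J2.
Qed.

(** * From the loop to a tester *)

Section Assembly.
Variables (R : realType) (n : nat) (G : erased_lists n) (K : nat) (be : rexp).
Variable beta : nat -> nat -> R.
Hypothesis n_gt0 : (0 < n)%N.
Hypothesis K_gt0 : (0 < K)%N.
Hypothesis beE : forall (M : nat -> nat) N, M 1%N = K ->
  reval M N be = beta (M 8%N).+1 (M 5%N).

(** The first hypothesis, stated for every [outcome_order], transfers both the safety analysis with
    [all id] and the rejection probability with [mean] from the loop to the whole program. *)
Lemma tests_of_loop P params (eps B : R) (M : nat -> nat) (N : nat -> R) tp k :
  (forall (T : Type) (le : T -> T -> Prop) avg hval bot,
    outcome_order G le avg hval bot -> forall t,
    le (run G avg hval bot t (Config [:: search_loop be] M N 0))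
       (run G avg hval bot (tp + t) (initial P n params))) ->
  between n K M -> M 13%N = 0%N -> M 3%N = 0%N -> N 5%N <= k%:R ->
  (far_from_connectedness eps G -> 2 / 3 <= loop_reject G be k M N 0) ->
  (tp + loop_fuel be k)%:R <= B ->
  tests_connectedness P params G eps B.
Proof.
move=> pre bM s13 M3 Nk rej tB.
have safe (b : bool) : (b -> has_connectedness G) ->
    run G (all id) (@safe_end R b k) false (tp + loop_fuel be k)
      (initial P n params).
  move=> bconn; apply: (pre _ _ _ _ _ (safe_order R G b k)).
  apply: (loop_safe n_gt0 K_gt0 beE) => //; [| by left | by rewrite M3].
  move=> /bconn[E [cE conn]] Q cQ Qn uQ; exact (closed_not_separating cE conn cQ Qn uQ).
exists (tp + loop_fuel be k)%N, k; split.
- split=> //; apply: le_trans tB; rewrite ler_nat /loop_fuel.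
  by rewrite (leq_trans _ (leq_addl _ _)) // leqW // leq_pmulr.
- by apply: (@safe_stops R n G false); apply: safe.
- by move=> hc; apply: (@safe_accepts R n G k); apply: safe.
move=> /rej far; apply: le_trans far _; rewrite prob_output_run.
exact: (pre _ _ _ _ _ (@reject_order R n G)).
Qed.

Variable E : {set {set 'I_n}}.
Hypothesis cE : completion G E.
Hypothesis not_connected : ~ connected_graph E.
Hypothesis beta_ge0 : forall D y, 0 <= beta D y.
Hypothesis hits : K%:R * #|unerased_components G E|%:R - n%:R <=
    \sum_(u <- iota 0 n) \sum_(y <- iota 0 K) (hit G E beta u y)%:R :> R.

(** A search hits with probability at least [s / (2 * n)], because the rounding loss [n] in [hits]
    is at most half of [K * s]. Hence [72 = 36 * 2]. *)
Lemma loop_reject_hits (s kappa W : R) k (M : nat -> nat) N :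
  0 < s -> s <= #|unerased_components G E|%:R -> 2 * n%:R <= K%:R * s ->
  0 < kappa -> 72 * n%:R * kappa <= s * W ->
  \sum_(u <- iota 0 n) \sum_(y <- iota 0 K) (2 + beta (degree_query G u).+1 y.+1)
    <= kappa * (n * K)%:R ->
  between n K M -> M 13%N = 0%N -> M 3%N = 0%N -> N 5%N = W -> W <= k%:R ->
  2 / 3 <= loop_reject G be k M N 0.
Proof.
move=> s0 sgood Ks k0 sW mean_cost bM s13 M3 NW Wk.
have n0 : 0 < n%:R :> R by rewrite ltr0n.
have good_n : #|unerased_components G E|%:R <= n%:R :> R.
  by rewrite ler_nat -[leqRHS]card_ord max_card.
have W0 : 0 < W.
  have : 0 < s * W by apply: lt_le_trans sW; rewrite !mulr_gt0.
  by rewrite pmulr_rgt0.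
apply: (loop_reject_ge n_gt0 K_gt0 beE (p := s / (2 * n%:R)) (kappa := kappa)
   (hit := hit G E beta)) NW Wk => //.
- have n2 : 0 < 2 * n%:R :> R by rewrite mulr_gt0.
  by rewrite (ltW (divr_gt0 s0 n2)) ler_pdivrMr //=; lra.
- exact: ltW.
- by move=> u y un; apply: hit_closed_list.
- apply: le_trans hits; rewrite natrM mulrA.
  rewrite (_ : s / (2 * n%:R) * n%:R = s / 2); last by field; lra.
  have : K%:R * s <= K%:R * #|unerased_components G E|%:R by rewrite ler_wpM2l.
  lra.
- by rewrite divr_gt0 ?mulr_gt0.
- by rewrite mulrAC ler_pdivlMr ?mulr_gt0 //; lra.
Qed.

End Assembly.

(** * Numerical bounds on the work *)

Section Bounds.
Variable R : realType.

Lemma ln2_ge : 1 / 2 <= ln (2 : R).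
Proof.
(* [ln (1 + x) <= x] at [x = - 1 / 2] reads [- ln 2 <= - 1 / 2]. *)
have := @le_ln1Dx R (- 2^-1); rewrite (_ : 1 + - 2^-1 = 2^-1 :> R); last by field.
rewrite lnV ?posrE //; lra.
Qed.

Lemma exponent_le (x : R) J c :
  2 <= x -> (2 ^ J)%:R <= x ^+ c -> J%:R <= 2 * c%:R * ln x.
Proof.
move=> x2; have x0 : 0 < x by lra.
rewrite -ler_ln ?posrE ?ltr0n ?expn_gt0 ?exprn_gt0 // natrX !lnXn //.
have : J%:R * (1 / 2) <= J%:R * ln 2 :> R by rewrite ler_wpM2l // ln2_ge.
rewrite -[ln 2 *+ J]mulr_natl -[ln x *+ c]mulr_natl => h1; lra.
Qed.

(** Absorbs constant factors under a logarithm into a power of [x]. *)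
Lemma pow2_le (x : R) c : 2 <= x -> (2 ^ c)%:R * x <= x ^+ c.+1.
Proof.
move=> x2; rewrite exprSr natrX ler_wpM2r ?lerXn2r ?nnegrE //; lra.
Qed.

Lemma ln_ge_half (x : R) : 2 <= x -> 1 / 2 <= ln x.
Proof.
by move=> x2; apply: le_trans ln2_ge _; rewrite ler_ln ?posrE //; lra.
Qed.

(** For [gap <= 1 / 2], [2 ^ J <= (1 / gap) ^ 5] makes [J] logarithmic; otherwise [J <= 4], and the
    1 in the maximum suffices. *)
Lemma component_work_bound (gap e : R) J : 0 < gap ->
  e = (if 1 <= gap then 1 else gap) -> (2 ^ J)%:R < 2 * (8 / e) ->
  1296 * J.+1%:R / e <= (100 * 160) * Num.max 1 (1 / gap * ln (1 / gap)).
Proof.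
move=> gap0 eE; have e0 : 0 < e by rewrite eE; case: ifP.
rewrite -natr1 mulrA ltr_pdivlMr // => Je.
have [x2|x2] := leP 2 (1 / gap).
  have gap2 : gap * 2 <= 1 by move: x2; rewrite ler_pdivlMr // mulrC.
  have {eE}eE : e = gap by rewrite eE; case: ifP => //; lra.
  set x := 1 / gap in x2 *; have xe : x * e = 1 by rewrite eE /x; field; lra.
  have x0 : 0 < x by lra.
  have pow : (2 ^ J)%:R <= x ^+ 5.
    have : (2 ^ J)%:R <= 16 * x.
      have : (2 ^ J)%:R * (x * e) <= 16 * x by rewrite mulrCA; nra.
      by rewrite xe mulr1.
    by move/le_trans; apply; apply: (pow2_le 4).
  have := exponent_le x2 pow; have := ln_ge_half x2 => l1 l2.
  apply: le_trans (_ : (100 * 160) * (x * ln x) <= _); last first.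
    by rewrite ler_wpM2l ?mulr_ge0 // le_max lexx orbT.
  rewrite ler_pdivrMr // (_ : _ * e = 100 * 160 * (x * e * ln x)); last by ring.
  by rewrite xe mul1r; lra.
have e2 : 1 / 2 < e.
  rewrite eE; case: ifP => _; first lra.
  by move: x2; rewrite ltr_pdivrMr //; lra.
have J32 : (J <= 4)%N.
  rewrite -ltnS -(@ltn_exp2l 2) // -(ltr_nat R).
  have : 0 <= (2 ^ J)%:R :> R by [].
  move: Je; set y := (2 ^ J)%:R; rewrite [(2 ^ 5)%:R](_ : _ = 32) //; nra.
apply: le_trans (_ : (100 * 160) * 1 <= _); last by rewrite ler_wpM2l ?mulr_ge0 // le_max lexx.
rewrite ler_pdivrMr //; move: J32; rewrite -(ler_nat R); lra.
Qed.

(** Let [x = 1 / (gap * d)]. For [x >= 2] the smaller term on the right bounds the corresponding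
    term on the left; for [x < 2], [2 ^ J < 16] and the quadratic term is at most a constant. *)
Lemma known_degree_work_bound (gap d : R) J : 0 < gap -> 0 < d ->
  (2 ^ J)%:R < 2 * (4 / (gap * d)) ->
  Num.min (216 * (2 ^ J)%:R * (2 ^ J)%:R) (1296 * J.+1%:R / gap) <=
  (200 * 300) * Num.max 1 (Num.min (1 / (gap * d) ^+ 2) (1 / gap * ln (1 / (gap * d)))).
Proof.
move=> gap0 d0; have gd0 : 0 < gap * d by rewrite mulr_gt0.
set K := (2 ^ J)%:R; have K0 : 0 <= K :> R by [].
rewrite (_ : 1 / (gap * d) ^+ 2 = (1 / (gap * d)) ^+ 2); last by rewrite expr_div_n expr1n.
rewrite (_ : 2 * (4 / (gap * d)) = 8 * (1 / (gap * d))); last by field; lra.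
set x := 1 / (gap * d) => Kx; have x0 : 0 < x by rewrite divr_gt0.
have [x2|x2] := leP 2 x; last first.
  apply: le_trans (_ : (200 * 300) * 1 <= _); last by rewrite ler_wpM2l ?mulr_ge0 // le_max lexx.
  by rewrite ge_min; apply/orP; left; nra.
apply: le_trans (_ : (200 * 300) * Num.min (x ^+ 2) (1 / gap * ln x) <= _); last first.
  by rewrite ler_wpM2l ?mulr_ge0 // le_max lexx orbT.
have pow : K <= x ^+ 4.
  by apply: le_trans (ltW Kx) _; apply: (pow2_le 3).
have := exponent_le x2 pow; have := ln_ge_half x2 => l1 l2.
have [_|_] := leP (x ^+ 2) (1 / gap * ln x); rewrite ge_min; apply/orP.
  by left; rewrite expr2; nra.
right; rewrite (_ : 200 * 300 * _ = 200 * 300 * ln x / gap); last by field; lra.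
by rewrite ler_wpM2r ?invr_ge0 ?(ltW gap0) // -natr1; lra.
Qed.

End Bounds.

Lemma loop_time (R : realType) be (W : R) J tp :
  (tp <= 60 + 6 * J)%N -> J%:R <= W -> 1 <= W ->
  (tp + loop_fuel be (Num.truncn W).+1)%:R <= 200 * W.
Proof.
move=> tpJ JW W1.
(* A pass takes 33 steps for any budget: 32 for the work unit and one for the loop test. *)
have -> : loop_fuel be (Num.truncn W).+1 = (33 * Num.truncn W + 34)%N.
  by rewrite /loop_fuel -[(cost _).+1]/33%N; lia.
set t := Num.truncn W.
have : t%:R <= W by rewrite truncn_le; lra.
have : tp%:R <= 60 + 6 * J%:R :> R by rewrite -natrM -natrD ler_nat.
rewrite natrD [(_ + 34)%:R]natrD natrM; lra.
Qed.

(** * Programs for known and unknown degree *)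

Definition rnat (k : nat) : rexp := ROfInt (ICst k).
Definition set_gap : prog := RStore 7 (RSub (RReg 1) (RAdd (RReg 0) (RReg 0))).
(** [1296 = 72 * 3 * 6]: the 3 comes from the mean cost, and [2 * m + n] is at most 6 times
    [max m (n / 4)]. *)
Definition component_work : rexp :=
  RDiv (RMul (rnat 1296) (ROfInt (IAdd (cell 2) (ICst 1)))) (RReg 7).
(** [72 * 6 * n * K <= s * (216 * K ^ 2)] as soon as [2 * n <= K * s]. *)
Definition square_work : rexp :=
  RMul (RMul (rnat 216) (ROfInt (cell 1))) (ROfInt (cell 1)).

(** Capping register 7 at 1 keeps its product [s] with [max m (n / 4)] below the number of unerased
    components, even in sparse graphs; the numerator 8 then gives [2 * n <= K * s]. *)
Definition unknown_degree_setup : prog := blk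
  [:: set_gap;
      If (BRle (rnat 1) (RReg 7)) (RStore 7 (rnat 1)) Skip;
      RStore 8 (RDiv (rnat 8) (RReg 7));
      IStore (ICst 1) (ICst 1)].

Definition unknown_degree_tester : prog :=
  Seq unknown_degree_setup (Seq doubling
    (Seq (RStore 5 component_work) (search_loop component_budget))).

(** As [gap * m = gap * d * n / 2], the choice [K >= 4 / (gap * d)] gives
    [2 * n <= K * (gap * m)]. *)
Definition known_degree_setup : prog := blk
  [:: set_gap;
      RStore 8 (RDiv (rnat 4) (RMul (RReg 7) (RReg 2)));
      IStore (ICst 1) (ICst 1)].

Definition known_degree_tester : prog :=
  If (BRle (rnat 1) (RReg 2))
    (Seq known_degree_setup (Seq doubling
      (Seq (blk [:: RStore 5 square_work; RStore 9 component_work])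
        (If (BRle (RReg 5) (RReg 9)) (search_loop square_budget)
          (Seq (RStore 5 (RReg 9)) (search_loop component_budget))))))
    (IStore (ICst 0) (ICst 0)).

Section Setup.
Variables (R : realType) (n : nat) (G : erased_lists n).

Lemma setup_run pre rest M0 (N0 : nat -> R) (M1 : nat -> nat) N1 :
  loop_free pre ->
  (forall T (avg : seq T -> T) f, wp G avg pre f M0 N0 0%N = f M1 N1 0%N) ->
  M1 1%N = 1%N -> M1 2%N = 0%N -> 1 < N1 8%N -> exists J M',
  [/\ N1 8%N <= (2 ^ J)%:R < 2 * N1 8%N, M' 1%N = (2 ^ J)%N, M' 2%N = J,
      forall a, a != 1%N -> a != 2%N -> M' a = M1 a &
      forall (T : Type) (le : T -> T -> Prop) avg hval bot,
        outcome_order G le avg hval bot -> forall t,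
        le (run G avg hval bot t (Config [:: rest] M' N1 0))
           (run G avg hval bot (cost pre + 6 * J + 3 + t)
             (Config [:: Seq pre (Seq doubling rest)] M0 N0 0))].
Proof.
move=> lf det M11 M12 N18.
have [J [M' [NJ M'1 M'2 M'a M'run]]] := doubling_run G 0 M11 M12 N18.
exists J, M'; split=> // T le avg hval bot ord t.
apply: (outcome_trans ord) (M'run _ _ _ _ _ ord [:: rest] t) _.
(* The 3 counts two [Seq] steps and the last test of [doubling]. *)
rewrite (_ : (cost pre + 6 * J + 3 + t)%N =
  (cost pre + (6 * J + 1 + t).+1).+1); last by lia.
rewrite (run_Seq ord) -(run_Seq ord _ doubling rest).
by have := run_wp ord (6 * J + 1 + t).+1 [:: Seq doubling rest] M0 N0 0 lf; rewrite det.
Qed.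

Lemma component_beta_ge0 K D y : 0 <= component_beta R K D y.
Proof. by rewrite divr_ge0 ?mulr_ge0. Qed.

Lemma square_beta_ge0 K D y : 0 <= square_beta R K D y.
Proof. by rewrite divr_ge0 ?mulr_ge0. Qed.

Lemma component_budgetE K (M : nat -> nat) (N : nat -> R) : M 1%N = K ->
  reval M N component_budget = component_beta R K (M 8%N).+1 (M 5%N).
Proof. by move=> <-; rewrite /= addn1. Qed.

Lemma square_budgetE K (M : nat -> nat) (N : nat -> R) : M 1%N = K ->
  reval M N square_budget = square_beta R K (M 8%N).+1 (M 5%N).
Proof. by move=> <-. Qed.

Variable E : {set {set 'I_n}}.
Hypothesis cE : completion G E.

Lemma num_edges_size : (\sum_(u < n) size (G u))%:R = 2 * num_edges R G.
Proof. by rewrite /num_edges [RHS]mulrC divfK ?pnatr_eq0. Qed.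

(** A connected completion is at distance 0 from itself, while two vertices force [m > 0]. *)
Lemma far_not_connected (eps : R) : 0 < eps -> (1 < n)%N ->
  far_from_connectedness eps G -> ~ connected_graph E.
Proof.
move=> eps0 n1 far conn; have [sE _] := cE.
have := far E E cE sE conn; rewrite /edge_distance setDv setU0 cards0 pmulr_rle0 //.
have := connected_size cE conn n1; rewrite -(ler_nat R) num_edges_size => le_m m0.
have : 1 < n%:R :> R by rewrite ltr1n.
lra.
Qed.

Lemma far_unerased (alpha eps : R) : (0 < n)%N ->
  (num_erased G)%:R <= 2 * alpha * #|E|%:R -> far_from_connectedness eps G ->
  (eps - 2 * alpha) * num_edges R G <= #|unerased_components G E|%:R.
Proof.
move=> n0; rewrite -(num_edgesE R cE) => er /(far_components cE n0).
have := erased_components_le G E; rewrite -(ler_nat R) natrD; lra.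
Qed.

Lemma component_loop_rejects J (s W : R) k (M : nat -> nat) N : (0 < n)%N ->
  ~ connected_graph E ->
  0 < s -> s <= #|unerased_components G E|%:R -> 2 * n%:R <= (2 ^ J)%:R * s ->
  216 * (2 * num_edges R G + n%:R) * J.+1%:R <= s * W ->
  between n (2 ^ J) M -> M 13%N = 0%N -> M 3%N = 0%N -> N 5%N = W -> W <= k%:R ->
  2 / 3 <= loop_reject G component_budget k M N 0.
Proof.
move=> n0 nconn s0 sgood Ks sW; have n0R : 0 < n%:R :> R by rewrite ltr0n.
have m0 : 0 <= num_edges R G by rewrite /num_edges divr_ge0.
apply: (loop_reject_hits n0 _ (@component_budgetE (2 ^ J)) cE nconn
  (@component_beta_ge0 (2 ^ J)) _ s0 sgood Ks
  (kappa := 3 * (2 * num_edges R G + n%:R) * J.+1%:R / n%:R)).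
- by rewrite expn_gt0.
- exact: component_hits.
- by rewrite divr_gt0 // !mulr_gt0 //; lra.
- by apply: le_trans sW; rewrite le_eqVlt; apply/orP; left; apply/eqP; field; lra.
- apply: le_trans (component_cost R G (erefl (2 ^ J)%N)) _.
  by rewrite natrM mulrA divfK // gt_eqF.
Qed.

Lemma square_loop_rejects K (s W : R) k (M : nat -> nat) N : (0 < n)%N -> (0 < K)%N ->
  ~ connected_graph E ->
  0 < s -> s <= #|unerased_components G E|%:R -> 2 * n%:R <= K%:R * s ->
  432 * n%:R * K%:R <= s * W ->
  between n K M -> M 13%N = 0%N -> M 3%N = 0%N -> N 5%N = W -> W <= k%:R ->
  2 / 3 <= loop_reject G square_budget k M N 0.
Proof.
move=> n0 K0 nconn s0 sgood Ks sW.
apply: (loop_reject_hits n0 K0 (@square_budgetE K) cE nconn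
  (@square_beta_ge0 K) _ s0 sgood Ks (kappa := 6 * K%:R)).
- exact: square_hits.
- by rewrite mulr_gt0 ?ltr0n.
- by apply: le_trans sW; lra.
- exact: square_cost.
Qed.

End Setup.

(** * Correctness of both testers *)

Lemma unknown_degree_tests (R : realType) n (G : erased_lists n) (alpha eps : R) :
  (1 < n)%N -> alpha_erased alpha G -> 0 < eps -> 0 <= alpha < eps / 2 ->
  tests_connectedness unknown_degree_tester [:: alpha; eps] G eps
    (big_O_bound (200 * (100 * 160))
       (1 / (eps - 2 * alpha) * ln (1 / (eps - 2 * alpha)))).
Proof.
move=> n1 [_ [E [cE er]]] eps0 /andP[al0 al]; have n0 := ltnW n1.
set gap := eps - 2 * alpha; have gap0 : 0 < gap by rewrite /gap; lra.
have gapE : eps - (alpha + alpha) = gap by rewrite /gap; ring.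
pose e := if 1 <= gap then 1 else gap.
have e0 : 0 < e by rewrite /e; case: ifP.
have [e1 e_gap] : e <= 1 /\ e <= gap.
  by rewrite /e; case: (leP 1 gap) => h; split=> //; lra.
pose M0 := update (fun=> 0%N) 0 n.
have [N1 [N17 N18 det]] : exists N1 : nat -> R, [/\ N1 7%N = e, N1 8%N = 8 / e &
    forall T (avg : seq T -> T) f,
      wp G avg unknown_degree_setup f M0 (nth 0 [:: alpha; eps]) 0%N =
      f (update M0 1 1%N) N1 0%N].
  rewrite /e; case: ifP => hgap; eexists; split; last first.
  - move=> T avg f; rewrite /= {2}/update /= gapE hgap; reflexivity.
  - by rewrite /update /=.
  - by rewrite /update /=.
  - move=> T avg f; rewrite /= {2}/update /= gapE hgap; reflexivity.
  - by rewrite /update /= ?gapE.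
  - by rewrite /update /= ?gapE.
have N18gt : 1 < N1 8%N by rewrite N18 ltr_pdivlMr //; lra.
have [J [M' [/andP[KJ JK] M'1 M'2 M'a M'run]]] :=
  @setup_run R n G unknown_degree_setup (Seq (RStore 5 component_work)
    (search_loop component_budget)) _ _ _ _ isT det erefl erefl N18gt.
pose W : R := 1296 * J.+1%:R / e.
have WE : reval M' N1 component_work = W by rewrite /= M'2 addn1 N17.
have J1 : 1 <= J.+1%:R :> R by rewrite ler1n.
have JW : J.+1%:R <= W by rewrite /W ler_pdivlMr //; nra.
apply: (tests_of_loop n0 _ (@component_budgetE R (2 ^ J)) (M := M')
  (N := update N1 5 (reval M' N1 component_work)) (k := (Num.truncn W).+1)
  (tp := (cost unknown_degree_setup + 6 * J + 3 + 2)%N)).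
- by rewrite expn_gt0.
- move=> T le avg hval bot ord t; rewrite -[(_ + 2 + t)%N]addnA.
  apply: (outcome_trans ord) _ (M'run _ _ _ _ _ ord (2 + t)%N).
  rewrite add2n (run_Seq ord).
  exact: (run_wp ord t [:: search_loop component_budget] M' N1 0
    (p := RStore 5 component_work) isT).
- split; first by rewrite M'a.
  + exact: M'1.
  + by move=> x xn; rewrite M'a // /update /=.
- by rewrite M'a.
- by rewrite M'a.
- by rewrite /update eqxx WE ltW // truncnS_gt.
- move=> far; pose m := num_edges R G.
  have m0 : 0 <= m by rewrite /m /num_edges divr_ge0.
  pose mm := Num.max m (n%:R / 4).
  have n0R : 1 < n%:R :> R by rewrite ltr1n.
  have [mm_m mm_n] : m <= mm /\ n%:R / 4 <= mm by rewrite /mm !le_max !lexx orbT.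
  apply: (component_loop_rejects cE n0 _ (s := e * mm) (W := W)) => //.
  + exact: far_not_connected far.
  + by rewrite mulr_gt0 //; lra.
  + have := far_unerased cE n0 er far; have := isolated_unerased cE.
    rewrite -(ler_nat R) natrD num_edges_size -/m -/gap /mm.
    (* For [m <= n / 4] there are at least [n - 2 * m >= n / 2] unerased components; otherwise
       farness provides [gap * m]. *)
    have [h|h] := leP m (n%:R / 4); first by nra.
    by move=> _; apply: le_trans; rewrite ler_wpM2r.
  + have : 8 <= (2 ^ J)%:R * e by rewrite -ler_pdivrMr // -N18.
    nra.
  + rewrite (_ : e * mm * W = 1296 * mm * J.+1%:R); last by rewrite /W; field; lra.
    by rewrite ler_wpM2r // -/m; lra.
  + split; first by rewrite M'a.
    * exact: M'1.
    * by move=> x xn; rewrite M'a // /update /=.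
  + by rewrite M'a.
  + by rewrite M'a.
  + by rewrite ltW // truncnS_gt.
have JW' : J%:R <= W by apply: le_trans JW; rewrite ler_nat.
apply: le_trans (_ : 200 * W <= _).
  apply: loop_time JW' _; last by apply: le_trans JW.
  by rewrite (_ : cost unknown_degree_setup = 10%N) //; clear; lia.
rewrite /big_O_bound -mulrA ler_wpM2l //.
by apply: component_work_bound => //; rewrite -N18.
Qed.

Lemma known_degree_tests (R : realType) n (G : erased_lists n) (alpha eps : R) :
  let d := avg_deg R G in
  alpha_erased alpha G -> 0 < eps < 2 / d -> 0 <= alpha < eps / 2 ->
  tests_connectedness known_degree_tester [:: alpha; eps; d] G eps
    (big_O_bound (200 * (200 * 300))
       (Num.min (1 / ((eps - 2 * alpha) * d) ^+ 2)
                (1 / (eps - 2 * alpha) * ln (1 / ((eps - 2 * alpha) * d))))).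
Proof.
move=> d [_ [E [cE er]]] /andP[eps0 epsd] /andP[al0 al].
set gap := eps - 2 * alpha; have gap0 : 0 < gap by rewrite /gap; lra.
have gapE : eps - (alpha + alpha) = gap by rewrite /gap; ring.
pose m := num_edges R G; have dE : d = 2 * m / n%:R by [].
have d0 : 0 < d.
  have : 0 < 2 / d by apply: lt_trans epsd.
  by rewrite pmulr_rgt0 // invr_gt0.
have n0R : 0 < n%:R :> R.
  rewrite lt_def ler0n andbT; apply/eqP => nz.
  by move: d0; rewrite dE nz invr0 mulr0 ltxx.
have mE : 2 * m = d * n%:R by rewrite dE divfK // gt_eqF.
have m0 : 0 < m by have := mulr_gt0 d0 n0R; rewrite -mE; lra.
have n1 : (1 < n)%N.
  have [sE _] := cE.
  have [e eE] : exists e, e \in E.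
    by apply/set0Pn; rewrite -card_gt0 -(ltr0n R) -(num_edgesE R cE).
  by rewrite -(sE e eE) -[leqRHS]card_ord max_card.
have n0 := ltnW n1.
pose M0 := update (fun=> 0%N) 0 n; pose N0 := nth 0 [:: alpha; eps; d].
have bound1 : 200 <= big_O_bound (200 * (200 * 300))
   (Num.min (1 / (gap * d) ^+ 2) (1 / gap * ln (1 / (gap * d)))).
  rewrite /big_O_bound; set f := Num.min _ _.
  have : 1 <= Num.max 1 f by rewrite le_max lexx.
  nra.
(* For [d < 1] no completion is connected, as that takes at least [n] list entries; the program
   rejects at once. *)
have [d1|d1] := leP 1 d; last first.
  have step1 (T : Type) (le : T -> T -> Prop) avg hval bot :
      outcome_order G le avg hval bot ->
      run G avg hval bot 2 (initial known_degree_tester n [:: alpha; eps; d]) =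
      hval (Config [::] (update M0 0 0%N) N0 0).
    move=> ord; rewrite /known_degree_tester (run_If ord) ifF.
      by rewrite /= (outcome_single ord).
    by rewrite /= leNgt d1.
  exists 2%N, 0%N; split.
  - by split; apply: le_trans bound1 => //; rewrite ler_nat.
  - by apply: (@safe_stops R n G false); rewrite (step1 _ _ _ _ _ (safe_order R G false 0)).
  - case=> E' [cE' conn]; have := connected_size cE' conn n1.
    rewrite -(ler_nat R) (num_edges_size R) -/m mE => le_n; exfalso.
    have : 0 < (1 - d) * n%:R by rewrite mulr_gt0 // subr_gt0.
    lra.
  - move=> _; rewrite prob_output_run (step1 _ _ _ _ _ (@reject_order R n G)).
    by rewrite /rejects /accepting /=; lra.
have [N1 [N17 N18 det]] : exists N1 : nat -> R, [/\ N1 7%N = gap,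
    N1 8%N = 4 / (gap * d) &
    forall T (avg : seq T -> T) f,
      wp G avg known_degree_setup f M0 N0 0%N = f (update M0 1 1%N) N1 0%N].
  eexists; split; last first.
  - move=> T avg f; rewrite /= {2}/update /= gapE; reflexivity.
  - by rewrite /update /= ?gapE.
  - by rewrite /update /= ?gapE.
have gapd : gap * d < 2.
  have : gap * d <= eps * d by rewrite ler_wpM2r ?(ltW d0) // /gap; lra.
  by move: epsd; rewrite ltr_pdivlMr //; lra.
have gd0 : 0 < gap * d by rewrite mulr_gt0.
have N18gt : 1 < N1 8%N by rewrite N18 ltr_pdivlMr //; lra.
have [J [M' [/andP[KJ JK] M'1 M'2 M'a M'run]]] :=
  @setup_run R n G known_degree_setup
    (Seq (blk [:: RStore 5 square_work; RStore 9 component_work])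
        (If (BRle (RReg 5) (RReg 9)) (search_loop square_budget)
          (Seq (RStore 5 (RReg 9)) (search_loop component_budget))))
    _ _ _ _ isT det erefl erefl N18gt.
pose W1 : R := 216 * (2 ^ J)%:R * (2 ^ J)%:R.
pose W2 : R := 1296 * J.+1%:R / gap.
have K0 : (0 < 2 ^ J)%N by rewrite expn_gt0.
have K1 : 1 <= (2 ^ J)%:R :> R by rewrite ler1n.
have J1 : 1 <= J.+1%:R :> R by rewrite ler1n.
have JK' : J.+1%:R <= (2 ^ J)%:R :> R by rewrite ler_nat ltn_expl.
have gap2 : gap < 2 by have : gap <= gap * d; nra.
have JW1 : J.+1%:R <= W1 by rewrite /W1; nra.
have JW2 : J.+1%:R <= W2 by rewrite /W2 ler_pdivlMr //; nra.
have Ks : 2 * n%:R <= (2 ^ J)%:R * (gap * m).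
  have : 4 <= (2 ^ J)%:R * (gap * d) by rewrite -ler_pdivrMr // -N18.
  have -> : gap * m = gap * d * n%:R / 2.
    by rewrite -[gap * d * n%:R]mulrA -mE; field.
  nra.
(* In this branch [d >= 1], so [2 * m + n <= 4 * m]. *)
have nm : n%:R <= 2 * m by rewrite mE; nra.
have work W : W = Num.min W1 W2 -> 200 * W <= big_O_bound (200 * (200 * 300))
    (Num.min (1 / (gap * d) ^+ 2) (1 / gap * ln (1 / (gap * d)))).
  move=> ->; rewrite /big_O_bound -mulrA ler_wpM2l //.
  by apply: known_degree_work_bound => //; rewrite -N18.
pose N2 := update (update N1 5 (reval M' N1 square_work)) 9
  (reval M' (update N1 5 (reval M' N1 square_work)) component_work).
have N25 : N2 5%N = W1 by rewrite /N2 /W1 /update /= M'1.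
have N29 : N2 9%N = W2 by rewrite /N2 /W2 /update /= M'2 addn1 N17.
have start (T : Type) (le : T -> T -> Prop) avg hval bot :
    outcome_order G le avg hval bot -> forall t,
    le (run G avg hval bot t (Config [:: if W1 <= W2 then search_loop square_budget
          else Seq (RStore 5 (RReg 9)) (search_loop component_budget)] M' N2 0))
       (run G avg hval bot (cost known_degree_setup + 6 * J + 11 + t)
          (initial known_degree_tester n [:: alpha; eps; d])).
  move=> ord t.
  rewrite (_ : (cost known_degree_setup + 6 * J + 11 + t)%N =
    (cost known_degree_setup + 6 * J + 3 + (5 + t.+1).+1).+1); last by clear; lia.
  rewrite /known_degree_tester (run_If ord) (_ : beval _ _ _ = true); last exact: d1.
  apply: (outcome_trans ord) _ (M'run _ _ _ _ _ ord (5 + t.+1).+1).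
  rewrite (run_Seq ord) -N25 -N29 -[N2 5%N <= _]/(beval M' N2 (BRle (RReg 5) (RReg 9))).
  rewrite -(run_If ord).
  exact: (run_wp ord t.+1 [:: If (BRle (RReg 5) (RReg 9)) (search_loop square_budget)
          (Seq (RStore 5 (RReg 9)) (search_loop component_budget))] M' N1 0
    (p := blk [:: RStore 5 square_work; RStore 9 component_work]) isT).
have setup_cost : cost known_degree_setup = 7%N by [].
have bM' : between n (2 ^ J) M'.
  split; first by rewrite M'a.
    exact: M'1.
  by move=> x xn; rewrite M'a // /update /=.
have gm0 : 0 < gap * m by rewrite mulr_gt0.
(* The program itself compares the two work bounds and runs the cheaper search. *)
have [W12|W12] := leP W1 W2.
  rewrite W12 in start.
  apply: (tests_of_loop n0 K0 (@square_budgetE R (2 ^ J)) start bM'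
    (k := (Num.truncn W1).+1)).
  - by rewrite M'a.
  - by rewrite M'a.
  - by rewrite N25 ltW // truncnS_gt.
  - move=> far.
    apply: (square_loop_rejects cE n0 K0 (far_not_connected cE eps0 n1 far) gm0
      (far_unerased cE n0 er far) Ks _ bM' _ _ N25 (ltW (truncnS_gt _))).
    + rewrite /W1; have := Ks; have := K1; set K := (2 ^ J)%:R => k1 ks.
      have : 216 * (K * (2 * n%:R)) <= 216 * (K * (K * (gap * m))).
        by rewrite !ler_wpM2l //; lra.
      lra.
    + by rewrite M'a.
    + by rewrite M'a.
  apply: le_trans (_ : 200 * W1 <= _); last by apply: work; apply/esym/min_idPl.
  apply: (@loop_time R _ W1 J) (le_trans _ JW1) (le_trans J1 JW1); last by rewrite ler_nat.
  by rewrite setup_cost; clear; lia.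
rewrite leNgt W12 /= in start.
apply: (tests_of_loop n0 K0 (@component_budgetE R (2 ^ J)) _ bM'
    (N := update N2 5 (N2 9%N)) (k := (Num.truncn W2).+1)
    (tp := (cost known_degree_setup + 6 * J + 11 + 2)%N)).
- move=> T le avg hval bot ord t; rewrite -[(_ + 2 + t)%N]addnA.
  apply: (outcome_trans ord) _ (start _ _ _ _ _ ord (2 + t)%N).
  rewrite add2n (run_Seq ord).
  exact: (run_wp ord t [:: search_loop component_budget] M' N2 0
    (p := RStore 5 (RReg 9)) isT).
- by rewrite M'a.
- by rewrite M'a.
- by rewrite /update eqxx N29 ltW // truncnS_gt.
- move=> far.
  apply: (component_loop_rejects cE n0 (far_not_connected cE eps0 n1 far) gm0
      (far_unerased cE n0 er far) Ks _ bM' (W := W2)).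
  + rewrite (_ : gap * m * W2 = 1296 * m * J.+1%:R); last by rewrite /W2; field; lra.
    by rewrite ler_wpM2r // -/m; lra.
  + by rewrite M'a.
  + by rewrite M'a.
  + by rewrite /update eqxx N29.
  + by rewrite ltW // truncnS_gt.
apply: le_trans (_ : 200 * W2 <= _); last by apply: work; apply/esym/min_idPr/ltW.
apply: (@loop_time R _ W2 J) (le_trans _ JW2) (le_trans J1 JW2); last by rewrite ler_nat.
by rewrite setup_cost; clear; lia.
Qed.

(* In the first part [eps < 2 / avg_deg R G] forces a positive average degree,
   as division by 0 yields 0.  In the second part the one-vertex graph is
   excluded: having no edge, it is both connected and far from connected. *)
Theorem theorem1p1 (R : realType) :
  (exists (P : prog) (C : R),
     forall (n : nat) (G : erased_lists n) (alpha eps : R),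
       let d := avg_deg R G in
       alpha_erased alpha G ->
       0 < eps < 2 / d ->
       0 <= alpha < eps / 2 ->
       tests_connectedness P [:: alpha; eps; d] G eps
         (big_O_bound C
            (Num.min (1 / ((eps - 2 * alpha) * d) ^+ 2)
                     (1 / (eps - 2 * alpha) *
                      ln (1 / ((eps - 2 * alpha) * d))))))
  /\
  (exists (P : prog) (C : R),
     forall (n : nat) (G : erased_lists n) (alpha eps : R),
       (1 < n)%N ->
       alpha_erased alpha G ->
       0 < eps ->
       0 <= alpha < eps / 2 ->
       tests_connectedness P [:: alpha; eps] G eps
         (big_O_bound C
            (1 / (eps - 2 * alpha) * ln (1 / (eps - 2 * alpha))))).
Proof.
split.
- exists known_degree_tester, (200 * (200 * 300)) => n G alpha eps d.
  exact: known_degree_tests.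
- exists unknown_degree_tester, (200 * (100 * 160)) => n G alpha eps.
  exact: unknown_degree_tests.
Qed.
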